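(* There exists a constant $C>0$ such that the following holds. Let $b=b(n)$ be an integer-valued function with $b\geq 2$ and $b=o\left(\frac{\ln n}{\ln\ln n}\right)$ (i.e. $b(n)\ln\ln n/\ln n\to 0$ as $n\to\infty$). Then for all sufficiently large $n$, Maker can win the $(1:b)$ Hamilton Cycle game played on $E(K_n)$ within $n+Cb^2\ln b$ moves.
   Context: A $(1:b)$ Maker-Breaker game on the edge set $E(G)$ of a graph $G$: two players, Maker and Breaker, alternately claim previously unclaimed edges of $G$, with Breaker going first; in each move Breaker claims $b$ unclaimed edges and Maker claims one unclaimed edge. In the Hamilton Cycle game on $E(K_n)$, Maker wins if the graph of his claimed edges contains a Hamilton cycle of $K_n$; Breaker wins otherwise. ''Maker can win within $m$ moves'' means Maker has a strategy guaranteeing that his graph contains a Hamilton cycle after at most $m$ of his own moves, whatever Breaker does. $\ln$ is the natural logarithm. *)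

(* Defs.v *)
From mathcomp Require Import all_boot.

Set Implicit Arguments.
Unset Strict Implicit.
Unset Printing Implicit Defensive.

(* Maker-Breaker games with bias (1 : b) on a finite board, Breaker going
   first.  Round i consists of Breaker's i-th move (a set of elements) followed
   by Maker's i-th move (one element), for i = 0, 1, 2 and so on. *)
Section MakerBreaker.

Variables (T : finType) (board : {set T}) (b : nat).

(* A strategy of Maker reads the list of all moves made so far by Breaker,
   oldest first; Maker's own earlier moves are determined by that list.  The
   answer need not be a legal move: legality is required in [wins_within]. *)
Definition maker_strategy := seq {set T} -> T.

(* Since strategies of Maker are deterministic, the behaviour of an adaptive
   Breaker against a fixed strategy is just a sequence of moves. *)
Definition breaker_play := nat -> {set T}.

Section Play.

Variables (sigma : maker_strategy) (F : breaker_play).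

Definition maker_move (i : nat) : T := sigma (mkseq F i.+1).

Definition maker_claimed (k : nat) : {set T} := [set maker_move i | i : 'I_k].

Definition breaker_claimed (k : nat) : {set T} := \bigcup_(i < k) F i.

Definition unclaimed (k : nat) : {set T} :=
  board :\: (maker_claimed k :|: breaker_claimed k).

(* Breaker claims exactly b unclaimed elements, or all of them when fewer than
   b are left. *)
Definition breaker_legal (i : nat) : bool :=
  (F i \subset unclaimed i) && (#|F i| == minn b #|unclaimed i|).

Definition maker_legal (i : nat) : bool :=
  maker_move i \in unclaimed i :\: F i.

End Play.

Definition wins_within (win : {set T} -> Prop) (sigma : maker_strategy)
    (m : nat) : Prop :=
  forall F : breaker_play, (forall i, breaker_legal sigma F i) ->
  exists k : nat, [/\ k <= m, forall i, i < k -> maker_legal sigma F i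
                    & win (maker_claimed sigma F k)].

Definition maker_can_win_within (win : {set T} -> Prop) (m : nat) : Prop :=
  exists sigma : maker_strategy, wins_within win sigma m.

End MakerBreaker.

(* Graphs on V are given by their edge sets, edges being two-element sets. *)
Definition complete_graph (V : finType) : {set {set V}} :=
  [set e : {set V} | #|e| == 2].

Definition adjacent (V : finType) (E : {set {set V}}) : rel V :=
  [rel x y | [set x; y] \in E].

(* The condition 2 < #|V| excludes the degenerate closed walks of length at
   most 2, which [cycle] accepts. *)
Definition contains_hamilton_cycle (V : finType) (E : {set {set V}}) : Prop :=
  2 < #|V| /\ exists c : seq V, ucycle (adjacent E) c /\ size c = #|V|.

Definition maker_can_win_hamilton_within (n b m : nat) : Prop :=
  maker_can_win_within (complete_graph 'I_n) b
    (@contains_hamilton_cycle 'I_n) m.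

(* Main.v *)
(* Maker first grows directed paths covering all vertices, joining the last
   vertex of one path to the first vertex of another, so that no move is wasted.
   Lasts and heads form the rows and columns of a square board, on which the
   cells spoilt by claimed edges are forbidden; a move deletes a row and a
   column crossing in an allowed cell.  If the deleted line has maximal degree
   and its partner the maximal degree among those allowed, the sum of
   (1 + 1/a)^deg - 1 over all lines, with a a large multiple of b, stays at most
   half the number of paths: deleting a line also lowers the degrees of the
   lines which cross it in a forbidden cell, which doubles the gain when all
   degrees are O(b).  Hence no line is ever full while more than O(b ln b) paths
   remain.  One move in four is spent on a path end of large claimed degree, so
   that all path ends keep many free edges.
   A longest path is then closed into a cycle and the other paths are inserted
   into it one by one, each at the cost of 2 b + 5 moves: the ends of the path
   are joined to b + 2 vertices of the cycle each, and Breaker cannot spoil all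
   of the (b + 2)^2 edges that would complete the insertion.  The waste is
   O(b) moves for each of O(b ln b) paths. *)

Require Import Defs.
From mathcomp Require Import all_boot all_order all_algebra.
From mathcomp Require Import zify ring lra boolp.

Set Implicit Arguments.
Unset Strict Implicit.
Unset Printing Implicit Defensive.

(** * Forcing positions *)

Section Reach.

Variables (T : finType) (board : {set T}) (b : nat).

Definition position_pred := {set T} -> {set T} -> Prop.

(* [M] is the set of Maker's elements, [G] the set of all claimed elements. *)
Fixpoint reach (k : nat) (P : position_pred) (M G : {set T}) : Prop :=
  P M G \/
  if k is k'.+1 then
    forall F : {set T}, F \subset board :\: G -> #|F| <= b ->
    exists2 e, e \in board :\: (G :|: F) &
               reach k' P (e |: M) (e |: (G :|: F))
  else False.

Lemma reach_now k (P : position_pred) M G : P M G -> reach k P M G.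
Proof. by case: k => [|k] PMG; left. Qed.

Lemma reach_le k k' (P : position_pred) M G :
  k <= k' -> reach k P M G -> reach k' P M G.
Proof.
elim: k k' M G => [|k IHk] [|k'] M G //= le_kk' [PMG|step] //; try by left.
right=> F sF cF; have [e eP re] := step F sF cF.
by exists e => //; apply: IHk.
Qed.

Lemma reach_step k (P : position_pred) M G :
  (forall F : {set T}, F \subset board :\: G -> #|F| <= b ->
    exists2 e, e \in board :\: (G :|: F) &
               reach k P (e |: M) (e |: (G :|: F))) ->
  reach k.+1 P M G.
Proof. by right. Qed.

(** Stages of play compose and their time bounds add up. A first target hit early does no harm:
    [reach_le] absorbs the rounds saved. *)
Lemma reach_bind k l (P Q : position_pred) M G :
    reach k P M G -> (forall M' G', P M' G' -> reach l Q M' G') ->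
  reach (k + l) Q M G.
Proof.
move=> + PQ; elim: k M G => [|k IHk] M G.
  by move=> [/PQ|].
case=> [/PQ|step]; first by apply: reach_le; rewrite leq_addl.
by right=> F sF cF; have [e eP /IHk re] := step F sF cF; exists e.
Qed.

Lemma reach_sub k (P Q : position_pred) M G :
  (forall M' G', P M' G' -> Q M' G') -> reach k P M G -> reach k Q M G.
Proof.
move=> sPQ /(@reach_bind _ 0 _ Q); rewrite addn0; apply=> M' G' /sPQ; exact: reach_now.
Qed.

(** Bookkeeping valid for every line of play: a round adds at most [b + 1] claimed elements.
    Attached to a target, it lets a later stage bound degrees by those of the starting position. *)
Lemma reach_growth k (P : position_pred) (M G : {set T}) :
    M \subset G -> G \subset board -> reach k P M G ->
  reach k (fun M' G' => [/\ P M' G', M \subset M', G \subset G',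
             M' \subset G' /\ G' \subset board & #|G' :\: G| <= b.+1 * k]) M G.
Proof.
elim: k M G => [|k IHk] M G sMG sGb.
  by case=> // PMG; left; split=> //; rewrite setDv cards0.
case=> [PMG|step]; first by left; split=> //; rewrite setDv cards0.
right=> F sF cF; have [e eP re] := step F sF cF; exists e => //.
move: eP sF; rewrite inE subsetD => /andP[_ eb] /andP[sFb _].
have sMG' : e |: M \subset e |: (G :|: F) by rewrite setUS // subsetU // sMG.
have sGb' : e |: (G :|: F) \subset board by rewrite subUset sub1set eb subUset sGb.
have {}re := IHk _ _ sMG' sGb' re.
apply: reach_sub re => M' G' [PM' sM sG sMGb cG]; split=> //.
- exact: subset_trans (subsetUr _ _) sM.
- exact: subset_trans (subset_trans (subsetUl _ _) (subsetUr _ _)) sG.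
set H := e |: _ in sG cG.
have sGG : G' :\: G \subset (G' :\: H) :|: (e |: F).
  apply/subsetP=> x; rewrite !inE => /andP[xG ->].
  by rewrite (negPf xG) /= !andbT; case: (_ == _); case: (_ \in _).
apply: leq_trans (subset_leq_card sGG) _.
apply: leq_trans (leq_card_setU _ _) _.
by rewrite mulnS addnC leq_add // cardsU1; case: (_ \notin _) => //=; lia.
Qed.

End Reach.

(** * From forcing positions to strategies *)

Section Strategy.

Variables (T : finType) (board : {set T}) (b : nat) (win : {set T} -> Prop).

Let won : position_pred T := fun M _ => win M.

Variable x0 : T.

Let good k (M G F : {set T}) e :=
  (e \in board :\: (G :|: F)) /\ reach board b k won (e |: M) (e |: (G :|: F)).

(** The default [x0] occurs only where no good answer exists, which does not happen along a play
    from a forcing position. *)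
Let answer k M G F : T := odflt x0 [pick e | `[< good k M G F e >]].

Let answerP k M G F : (exists e, good k M G F e) -> good k M G F (answer k M G F).
Proof.
rewrite /answer; case: pickP => [e /asboolP //|nogood [e ge]].
by have /asboolP[] := nogood e.
Qed.

(** A state consists of the number of rounds left, Maker's elements and all claimed elements. *)
Let step (st : nat * {set T} * {set T}) F :=
  let e := answer st.1.1.-1 st.1.2 st.2 F in
  (st.1.1.-1, e |: st.1.2, e |: (st.2 :|: F)).

(** All moves of Breaker but the last are replayed to recover the position; the last one is the move
    to be answered. *)
Let sigma k : maker_strategy T := fun s =>
  let st := foldl step (k, set0, set0) (take (size s).-1 s) in
  answer st.1.1.-1 st.1.2 st.2 (last set0 s).

Let state k (F : breaker_play T) i := foldl step (k, set0, set0) (mkseq F i).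

Let sigmaE k F i : maker_move (sigma k) F i =
  answer (state k F i).1.1.-1 (state k F i).1.2 (state k F i).2 (F i).
Proof.
by rewrite /maker_move /sigma mkseqS size_rcons /= last_rcons -cats1 take_size_cat // size_mkseq.
Qed.

Let maker_claimedS (s : maker_strategy T) F i :
  maker_claimed s F i.+1 = maker_move s F i |: maker_claimed s F i.
Proof.
apply/setP=> x; rewrite !inE; apply/imsetP/orP => [[j _ ->]|[/eqP ->|/imsetP[j _ ->]]].
- have := ltn_ord j; rewrite ltnS leq_eqVlt => /orP[/eqP ->|lt_ji]; [by left|right].
  by apply/imsetP; exists (Ordinal lt_ji).
- by exists ord_max.
- by exists (widen_ord (leqnSn _) j).
Qed.

Let stateE k F i : state k F i =
  (k - i, maker_claimed (sigma k) F i,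
   maker_claimed (sigma k) F i :|: breaker_claimed F i).
Proof.
elim: i => [|i IHi].
  rewrite /state /= subn0 /breaker_claimed big_ord0.
  have -> : maker_claimed (sigma k) F 0 = set0.
    by apply/setP=> x; rewrite inE; apply/imsetP => -[[]].
  by rewrite setU0.
have -> : state k F i.+1 = step (state k F i) (F i).
  by rewrite /state mkseqS -cats1 foldl_cat.
rewrite /step -sigmaE IHi /= maker_claimedS /breaker_claimed big_ord_recr /=.
by rewrite subnS !setUA.
Qed.

(** Along a legal play the position stays forcing, with one round fewer each time, until the target
    is met. A legal move of Breaker is among those over which [reach] quantifies. *)
Lemma reach_wins k :
  reach board b k won set0 set0 -> maker_can_win_within board b win k.
Proof.
move=> re; exists (sigma k) => F legal.
suff: forall l i, i + l = k ->
    reach board b l won (state k F i).1.2 (state k F i).2 ->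
    exists j, [/\ j <= k, forall i', i <= i' < j ->
       maker_legal board (sigma k) F i' & win (maker_claimed (sigma k) F j)].
  move=> /(_ k 0 erefl re)[j [jk leg wj]]; exists j; split=> // i lt_ij; exact: leg.
elim=> [|l IHl] i ilk.
  rewrite stateE /= => -[] // wj; exists i; split=> //; first by lia.
  by move=> i'; lia.
rewrite stateE /= => -[wj|].
  by exists i; split=> //; [lia|move=> i'; lia].
have /andP[sF cF] := legal i.
move=> /(_ (F i) sF)[|e eP re']; first by rewrite (eqP cF) geq_minl.
have kl : k - i.+1 = l by lia.
have := @answerP l (maker_claimed (sigma k) F i) (maker_claimed (sigma k) F i :|: breaker_claimed F i) (F i) _.
have aE : maker_move (sigma k) F i = answer l (maker_claimed (sigma k) F i) (maker_claimed (sigma k) F i :|: breaker_claimed F i) (F i).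
  by rewrite sigmaE stateE /= -subnS kl.
case; first by exists e.
rewrite -aE => mP re''.
have [||j [jk leg wj]] := IHl i.+1; first by lia.
  by rewrite stateE /= maker_claimedS /breaker_claimed big_ord_recr /= setUA in re'' *; rewrite -!setUA in re'' *.
exists j; split=> // i'; rewrite leq_eqVlt => /andP[/orP[/eqP <-|lt_ii'] lt_j].
  by rewrite /maker_legal /unclaimed setDDl.
by apply: leg; rewrite lt_ii'.
Qed.

End Strategy.

(** * A potential for forbidden cells *)

Section Potential.
Import Order.TTheory GRing.Theory Num.Theory.
Local Open Scope ring_scope.

Variables (T : finType) (R : realFieldType) (a : nat).
Hypothesis a_gt0 : (0 < a)%N.

Implicit Types (O I : {set T}) (F : {set T * T}).

Definition row_deg I F o : nat := #|[set i in I | (o, i) \in F]|.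
(** Transposition of the board: it turns each statement about rows into one about columns. *)
Definition swap F : {set T * T} := [set z | (z.2, z.1) \in F].
Definition base : R := 1 + a%:R^-1.
Definition weight d : R := base ^+ d - 1.
Definition rows O I F : R := \sum_(o in O) weight (row_deg I F o).
Definition potential O I F : R := rows O I F + rows I O (swap F).

Lemma swapK F : swap (swap F) = F.
Proof. by apply/setP=> -[o i]; rewrite !inE. Qed.

Lemma card_swap F : #|swap F| = #|F|.
Proof.
have -> : swap F = (fun z => (z.2, z.1)) @: F.
  apply/setP=> -[o i]; rewrite inE /=; apply/idP/imsetP => [H|[[u v] H [-> ->]] //].
  by exists (i, o).
by rewrite card_imset // => -[u v] [u' v'] [-> ->].
Qed.

Lemma potentialC O I F : potential I O (swap F) = potential O I F.
Proof. by rewrite /potential swapK addrC. Qed.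

Lemma step_gt0 : 0 < base - 1.
Proof. by rewrite /base addrC addKr invr_gt0 ltr0n. Qed.

Lemma base_ge1 : 1 <= base.
Proof. by have := step_gt0; lra. Qed.

Lemma base_gt0 : 0 < base.
Proof. by have := base_ge1; lra. Qed.

Lemma weight_ge0 d : 0 <= weight d.
Proof. by rewrite subr_ge0 exprn_ege1 // base_ge1. Qed.

Lemma weightS d : weight d.+1 = weight d + (base - 1) * base ^+ d.
Proof. by rewrite /weight exprS; ring. Qed.

Lemma weight_le d e : (d <= e)%N -> weight d <= weight e.
Proof. by move=> de; rewrite lerD2r ler_weXn2l // base_ge1. Qed.

Lemma weight_stepS d : weight d + (base - 1) <= weight d.+1.
Proof.
rewrite weightS lerD2l -{1}[base - 1]mulr1 ler_wpM2l ?(ltW step_gt0) //.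
by rewrite exprn_ege1 // base_ge1.
Qed.

Lemma weight_linear d : (base - 1) * d%:R <= weight d.
Proof.
elim: d => [|d IHd]; first by rewrite mulr0 weight_ge0.
by have := weight_stepS d; rewrite -natr1 mulrDr mulr1; lra.
Qed.

Lemma weight_diff d n D : (d + n <= D)%N ->
  weight (d + n) <= weight d + n%:R * ((base - 1) * base ^+ D).
Proof.
elim: n => [|n IHn] le_D; first by rewrite addn0 mul0r addr0.
rewrite addnS weightS -natr1.
have /IHn IH : (d + n <= D)%N by lia.
have : (base - 1) * base ^+ (d + n) <= (base - 1) * base ^+ D.
  by rewrite ler_pM2l ?step_gt0 // ler_weXn2l ?base_ge1 //; lia.
by rewrite [(n%:R + 1) * _]mulrDl mul1r; move: IH; lra.
Qed.

Lemma rows_ge0 O I F : 0 <= rows O I F.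
Proof. by apply: sumr_ge0 => o _; apply: weight_ge0. Qed.

Lemma card_cells O I F :
  #|F :&: setX O I| = (\sum_(o in O) row_deg I F o)%N.
Proof.
rewrite -sum1_card; under [RHS]eq_bigr => o _ do rewrite /row_deg -sum1_card.
rewrite pair_big_dep /=; apply: eq_bigl => -[o i]; rewrite !inE /=.
by case: (o \in O); case: (i \in I); case: (_ \in F).
Qed.

(** Each new cell raises one row degree by one, at a cost of at most [(base - 1) * base ^+ D] since
    no final degree exceeds [D]. *)
Lemma rows_increase O I F1 F2 D : F1 \subset F2 ->
    (forall o, o \in O -> (row_deg I F2 o <= D)%N) ->
  rows O I F2 <= rows O I F1 +
     #|(F2 :\: F1) :&: setX O I|%:R * ((base - 1) * base ^+ D).
Proof.
move=> s12 leD; rewrite card_cells natr_sum mulr_suml -big_split /=.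
apply: ler_sum => o oO; have := leD o oO.
have -> : row_deg I F2 o = (row_deg I F1 o + row_deg I (F2 :\: F1) o)%N.
  rewrite /row_deg -(cardsID [set i | (o, i) \in F1]); congr (_ + _)%N.
    apply: eq_card => i; rewrite !inE; case: (i \in I) => //=.
    by have := subsetP s12 (o, i); case: (_ \in F1) => [->//|_]; rewrite andbF.
  by apply: eq_card => i; rewrite !inE; case: (i \in I); rewrite /= ?andbT ?andbF.
exact: weight_diff.
Qed.

Lemma potential_increase O I F1 F2 D c : F1 \subset F2 ->
    (#|(F2 :\: F1) :&: setX O I| <= c)%N ->
    (forall o, o \in O -> (row_deg I F2 o <= D)%N) ->
    (forall i, i \in I -> (row_deg O (swap F2) i <= D)%N) ->
  potential O I F2 <= potential O I F1 + c%:R * 2 * ((base - 1) * base ^+ D).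
Proof.
move=> s12 cF rD cD.
have s12' : swap F1 \subset swap F2.
  by apply/subsetP=> z; rewrite !inE; apply: (subsetP s12).
have := rows_increase s12 rD; have := rows_increase s12' cD.
have -> : #|(swap F2 :\: swap F1) :&: setX I O| = #|(F2 :\: F1) :&: setX O I|.
  rewrite -card_swap; apply: eq_card => -[o i]; rewrite !inE /=.
  by rewrite [(_ \in I) && _]andbC.
set y := (base - 1) * _; have y0 : 0 <= y by rewrite mulr_ge0 ?exprn_ge0 ?(ltW step_gt0) ?(ltW base_gt0).
have : #|(F2 :\: F1) :&: setX O I|%:R * y <= c%:R * y by rewrite ler_wpM2r // ler_nat.
by rewrite /potential; lra.
Qed.

(* The line weight together with the first-order gain that deleting a line of
   degree [d] brings to the [d] lines crossing it in a forbidden cell. *)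
Definition gain d : R := weight d + (base - 1) * d%:R.

(** Row [o] takes its weight away, and every row that forbids column [j] loses one degree, hence at
    least [base - 1]. As [(o, j)] is allowed, row [o] is not one of the latter, so the two savings
    add up. *)
Lemma rows_remove O I F o j : o \in O -> j \in I -> (o, j) \notin F ->
  rows (O :\ o) (I :\ j) F <=
  rows O I F - weight (row_deg I F o) - (base - 1) * (row_deg O (swap F) j)%:R.
Proof.
move=> oO jI ojF; rewrite {2}/rows (big_setD1 o) //= [weight _ + _]addrC addrK.
have -> : row_deg O (swap F) j = (\sum_(o' in O :\ o) ((o', j) \in F))%N.
  rewrite /row_deg -sum1dep_card [RHS]big_mkcond [LHS]big_mkcond /=.
  apply: eq_bigr => o' _; rewrite !inE /=; case: eqP => [->|_] /=; last by do 2 case: (_ \in _).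
  by rewrite (negPf ojF) andbF.
rewrite natr_sum mulr_sumr -sumrB; apply: ler_sum => o' _.
have [o'F|o'F] := boolP ((o', j) \in F); last first.
  rewrite mulr0 subr0; apply: weight_le; apply: subset_leq_card; apply/subsetP=> i.
  by rewrite !inE => /andP[/andP[_ ->] ->].
have -> : row_deg I F o' = (row_deg (I :\ j) F o').+1.
  rewrite /row_deg (cardsD1 j) !inE jI o'F add1n; congr _.+1; apply: eq_card => i.
  by rewrite !inE andbA.
by rewrite mulr1; have := weight_stepS (row_deg (I :\ j) F o'); lra.
Qed.

Lemma potential_remove O I F o j : o \in O -> j \in I -> (o, j) \notin F ->
  potential (O :\ o) (I :\ j) F <=
  potential O I F - gain (row_deg I F o) - gain (row_deg O (swap F) j).
Proof.
move=> oO jI ojF; have := rows_remove oO jI ojF.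
have joF : (j, o) \notin swap F by rewrite inE.
have := rows_remove jI oO joF; rewrite swapK /potential /gain.
by lra.
Qed.


Lemma gain_ge0 d : 0 <= gain d.
Proof. by rewrite addr_ge0 ?weight_ge0 ?mulr_ge0 ?(ltW step_gt0). Qed.

Lemma gain_le d e : (d <= e)%N -> gain d <= gain e.
Proof. by move=> de; rewrite lerD ?weight_le // ler_wpM2l ?ler_nat ?(ltW step_gt0). Qed.

(** While [base ^+ d <= 2], the weight is at most twice its linear part, so the linear term of
    [gain] adds at least half the weight. *)
Lemma gain_weight d : base ^+ d <= 2 -> 3 / 2 * weight d <= gain d.
Proof.
move=> b2; have := @weight_diff 0 d d (leqnn _).
rewrite add0n {2}/weight expr0 subrr add0r /gain => wd.
have : d%:R * ((base - 1) * base ^+ d) <= d%:R * ((base - 1) * 2).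
  by rewrite ler_wpM2l // ler_wpM2l // ltW ?step_gt0.
by lra.
Qed.

Lemma row_deg_increase O I F1 F2 o c : F1 \subset F2 -> o \in O ->
    (#|(F2 :\: F1) :&: setX O I| <= c)%N ->
  (row_deg I F2 o <= row_deg I F1 o + c)%N.
Proof.
move=> s12 oO; rewrite card_cells (big_setD1 o) //= => cF.
suff : (row_deg I F2 o <= row_deg I F1 o + row_deg I (F2 :\: F1) o)%N by lia.
apply: leq_trans (leq_card_setU _ _); apply/subset_leq_card/subsetP=> i.
by rewrite !inE => /andP[-> ->]; rewrite andbT orbN.
Qed.

(** A full row had degree at least [m - c] before the new cells appeared; its weight alone was then
    at least [m + 2], more than [X]. *)
Lemma row_deg_lt O I F1 F2 o c m X : F1 \subset F2 -> o \in O ->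
    (#|(F2 :\: F1) :&: setX O I| <= c)%N ->
    m%:R + 3 <= base ^+ (m - c) ->
    potential O I F1 <= X -> X <= m%:R / 2 + 1 / 2 ->
  (row_deg I F2 o < m)%N.
Proof.
move=> s12 oO cF big_m leX Xm; rewrite ltnNge; apply/negP => le_m.
have := row_deg_increase s12 oO cF => le_d.
have wo : weight (row_deg I F1 o) <= X.
  apply: le_trans leX; rewrite /potential /rows (big_setD1 o) //= -addrA lerDl.
  by rewrite addr_ge0 ?rows_ge0 //; apply: sumr_ge0 => ? _; apply: weight_ge0.
have /weight_le : (m - c <= row_deg I F1 o)%N by lia.
have : 0 <= m%:R :> R by [].
by move: wo; rewrite /weight; lra.
Qed.

Lemma choose_partner O I F1 F2 o c m X : F1 \subset F2 -> o \in O ->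
    (#|(F2 :\: F1) :&: setX O I| <= c)%N -> #|I| = m ->
    m%:R + 3 <= base ^+ (m - c) ->
    potential O I F1 <= X -> X <= m%:R / 2 + 1 / 2 ->
  exists j, [/\ j \in I, (o, j) \notin F2 & forall i, i \in I -> (o, i) \notin F2 ->
                (row_deg O (swap F2) i <= row_deg O (swap F2) j)%N].
Proof.
move=> s12 oO cF cI big_m leX Xm.
have lt_m := row_deg_lt s12 oO cF big_m leX Xm.
have [j0 j0P] : exists j, (j \in I) && ((o, j) \notin F2).
  apply/existsP; apply: contraLR lt_m; rewrite -leqNgt negb_exists => /forallP nj.
  rewrite -cI; apply/subset_leq_card/subsetP=> i iI; rewrite inE iI /=.
  by have := nj i; rewrite iI negbK.
have [j /andP[jI jF] max_j] := @arg_maxnP _ j0 (fun j => (j \in I) && ((o, j) \notin F2))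
  (row_deg O (swap F2)) j0P.
by exists j; split=> // i iI iF; apply: max_j; rewrite iI iF.
Qed.

(** The case in which a row [o] has the largest degree [D] of all lines. When [base ^+ D < 2],
    averaging and [m / 2 <= X] yield a drop of about 3/4. The new cells cost at most 1/32, and the
    at most [a] columns that [o] cannot use cost at most [2 a / m <= 1 / 20]; this leaves 2/3. *)
Lemma choose_max_row O I F1 F2 o c m X :
    a = (128 * c)%N -> #|O| = m -> #|I| = m -> F1 \subset F2 ->
    (#|(F2 :\: F1) :&: setX O I| <= c)%N -> (40 * a <= m)%N ->
    m%:R + 3 <= base ^+ (m - c) -> potential O I F1 <= X ->
    m%:R / 2 <= X <= m%:R / 2 + 1 / 2 ->
    o \in O -> (forall o', o' \in O -> row_deg I F2 o' <= row_deg I F2 o)%N ->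
    (forall i, i \in I -> row_deg O (swap F2) i <= row_deg I F2 o)%N ->
  exists j, [/\ j \in I, (o, j) \notin F2 &
    potential (O :\ o) (I :\ j) F2 <= X - 2 / 3].
Proof.
move=> ac cO cI s12 cF am big_m leX /andP[mX Xm] oO max_o max_i.
have [j [jI jF max_j]] := choose_partner s12 oO cF cI big_m leX Xm.
exists j; split=> //.
have := potential_remove oO jI jF.
have := potential_increase s12 cF max_o max_i.
set D := row_deg I F2 o in max_o max_i *; set d := row_deg O (swap F2) j in max_j *.
have -> : c%:R * 2 * ((base - 1) * base ^+ D) = base ^+ D / 64.
  rewrite /base [1 + _]addrC addrK ac natrM invfM; set B := (_ ^+ _).
  by field; rewrite pnatr_eq0; move: a_gt0; rewrite ac; lia.
set P1 := potential O I F1 in leX *; set P2 := potential O I F2; set P3 := potential _ _ F2.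
move=> P12 P23; have dj0 := gain_ge0 d.
have m_gt1 : 2 <= m%:R :> R by rewrite ler_nat; move: a_gt0; lia.
(* When [base ^+ D >= 2] the heaviest line alone pays for the round; otherwise
   the weights are nearly linear, and averaging gives [gain >= 3/2 weight]. *)
have [B2|B2] := lerP 2 (base ^+ D).
  have : 0 <= (base - 1) * D%:R :> R by rewrite mulr_ge0 // ltW ?step_gt0.
  by move: P23; rewrite {1}/gain /weight; lra.
have sub2 e : (e <= D)%N -> base ^+ e <= 2.
  by move=> eD; apply: le_trans (ltW B2); rewrite ler_weXn2l ?base_ge1.
have linD := weight_linear D.
have gD2 : gain D <= 2 by move: linD B2; rewrite /gain /weight; lra.
have Da : D%:R <= a%:R :> R.
  have : (base - 1) * D%:R <= 1 by move: linD B2; rewrite /weight; lra.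
  by rewrite /base [1 + _]addrC addrK mulrC ler_pdivrMr ?ltr0n // mul1r.
have rowsP : 3 / 2 * rows O I F2 <= m%:R * gain D.
  rewrite /rows mulr_sumr -cO [#|_|%:R * _]mulr_natl -sumr_const.
  apply: ler_sum => o' o'O; apply: le_trans (gain_le (max_o _ o'O)).
  by apply/gain_weight/sub2/max_o.
(* The [D] columns forbidden to [o] are bounded by the overall maximum, all others by the chosen
   partner [j]. *)
have colsP : 3 / 2 * rows I O (swap F2) <= D%:R * gain D + m%:R * gain d.
  have leI : #|[set i in I | (o, i) \notin F2]|%:R * gain d <= m%:R * gain d.
    rewrite ler_wpM2r // -cI ler_nat; apply/subset_leq_card/subsetP=> i.
    by rewrite inE => /andP[].
  apply: le_trans (lerD (lexx _) leI).
  rewrite /rows mulr_sumr (bigID (fun i => (o, i) \in F2)) /=.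
  have -> : D%:R * gain D = \sum_(i in [set i in I | (o, i) \in F2]) gain D.
    by rewrite sumr_const mulr_natl.
  rewrite [#|_|%:R * _]mulr_natl -sumr_const; apply: lerD.
    rewrite big_mkcond [leRHS]big_mkcond /=; apply: ler_sum => i _; rewrite inE.
    case: ifP => // /andP[iI iF]; apply: le_trans (gain_le (max_i _ iI)).
    by apply/gain_weight/sub2/max_i.
  rewrite big_mkcond [leRHS]big_mkcond /=; apply: ler_sum => i _; rewrite inE.
  case: ifP => // /andP[iI iF]; apply: le_trans (gain_le (max_j _ iI iF)).
  by apply/gain_weight/sub2/max_i.
have am' : 40 * a%:R <= m%:R :> R by rewrite -natrM ler_nat.
have DgD : D%:R * gain D <= a%:R * 2 by rewrite ler_pM ?gain_ge0.
have P2E : P2 = rows O I F2 + rows I O (swap F2) by [].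
have P2X : (m%:R - 3 / 2) * P2 <= (m%:R - 3 / 2) * (X + 1 / 32).
  by rewrite ler_wpM2l //; lra.
rewrite -(@ler_pM2l _ m%:R); last by lra.
have : m%:R * P3 <= m%:R * (P2 - gain D - gain d) by rewrite ler_wpM2l.
by lra.
Qed.

(** The heaviest line may be a row or a column; the second case is the first one on the transposed
    board. *)
Lemma choose_cell O I F1 F2 c m X :
    a = (128 * c)%N -> #|O| = m -> #|I| = m -> F1 \subset F2 ->
    (#|(F2 :\: F1) :&: setX O I| <= c)%N -> (40 * a <= m)%N ->
    m%:R + 3 <= base ^+ (m - c) -> potential O I F1 <= X ->
    m%:R / 2 <= X <= m%:R / 2 + 1 / 2 ->
  exists o j, [/\ o \in O, j \in I, (o, j) \notin F2 &
    potential (O :\ o) (I :\ j) F2 <= X - 2 / 3].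
Proof.
move=> ac cO cI s12 cF am big_m leX mX.
have m_gt0 : (0 < m)%N by move: a_gt0; lia.
have [o oO max_o] : {o | o \in O & \max_(o' in O) row_deg I F2 o' = row_deg I F2 o}.
  by apply: eq_bigmax_cond; rewrite cO.
have [i iI max_i] : {i | i \in I & \max_(i' in I) row_deg O (swap F2) i' = row_deg O (swap F2) i}.
  by apply: eq_bigmax_cond; rewrite cI.
have max_o' o' : o' \in O -> (row_deg I F2 o' <= row_deg I F2 o)%N.
  by rewrite -max_o; apply: leq_bigmax_cond.
have max_i' i' : i' \in I -> (row_deg O (swap F2) i' <= row_deg O (swap F2) i)%N.
  by rewrite -max_i; apply: leq_bigmax_cond.
case: (leqP (row_deg O (swap F2) i) (row_deg I F2 o)) => [le_io|/ltnW le_oi].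
  have [j [jI jF Pj]] := choose_max_row ac cO cI s12 cF am big_m leX mX oO max_o'
    (fun i' i'I => leq_trans (max_i' i' i'I) le_io).
  by exists o, j.
have s12' : swap F1 \subset swap F2.
  by apply/subsetP=> z; rewrite !inE; apply: (subsetP s12).
have cF' : (#|(swap F2 :\: swap F1) :&: setX I O| <= c)%N.
  rewrite -card_swap; apply: leq_trans cF; apply/subset_leq_card/subsetP=> -[x y].
  by rewrite !inE /= [(_ \in I) && _]andbC.
have leX' : potential I O (swap F1) <= X by rewrite potentialC.
have max_o'' : forall o', o' \in O -> (row_deg O (swap F2) i >= row_deg I (swap (swap F2)) o')%N.
  by move=> o' o'O; rewrite swapK; apply: leq_trans (max_o' _ o'O) le_oi.
have [j [jO jF Pj]] := choose_max_row ac cI cO s12' cF' am big_m leX' mX iI max_i' max_o''.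
by exists j, i; split=> //; [rewrite inE in jF | rewrite potentialC in Pj].
Qed.

End Potential.

(** * Path covers *)

Lemma sorted_cat_edge (T : eqType) (x0 : T) (e : rel T) (p1 p2 : seq T) :
    p1 != [::] -> p2 != [::] -> sorted e p1 -> sorted e p2 ->
    e (last x0 p1) (head x0 p2) ->
  sorted e (p1 ++ p2).
Proof.
case: p1 => // x p1 _; case: p2 => // y p2 _ /= px py exy.
by rewrite cat_path /= px exy.
Qed.

Section PathCovers.

Variables (V : finType) (x0 : V).

Implicit Types (ps : seq (seq V)) (M G F : {set {set V}}).

Definition path_cover ps M :=
  [/\ all (fun p => p != [::]) ps, perm_eq (flatten ps) (enum V)
    & all (sorted (adjacent M)) ps].

Definition lasts ps : {set V} := [set v in [seq last x0 p | p <- ps]].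
Definition heads ps : {set V} := [set v in [seq head x0 p | p <- ps]].
(** Joining the last vertex of a path to its own head would close the path prematurely, hence these
    cells are forbidden. *)
Definition closing_cells ps : {set V * V} :=
  [set z in [seq (last x0 p, head x0 p) | p <- ps]].
(** A claimed edge spoils two cells, one for each orientation. *)
Definition edge_cells G : {set V * V} := [set z | [set z.1; z.2] \in G].
Definition forbidden ps G := closing_cells ps :|: edge_cells G.

Lemma last_mem (p : seq V) : p != [::] -> last x0 p \in p.
Proof. by case: p => // x s _; apply: (mem_last x s). Qed.

Lemma head_mem (p : seq V) : p != [::] -> head x0 p \in p.
Proof. by case: p => // x s _; rewrite mem_head. Qed.

Lemma uniq_representatives (rep : seq V -> V) ps :
    (forall p, p != [::] -> rep p \in p) ->
    all (fun p => p != [::]) ps -> uniq (flatten ps) ->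
  uniq [seq rep p | p <- ps].
Proof.
move=> repP; elim: ps => //= p ps IHps /andP[p0 ps0].
rewrite cat_uniq => /and3P[_ /hasPn dis /(IHps ps0) ->]; rewrite andbT.
apply/mapP => -[p' p'ps eq_rep]; have /dis : rep p' \in flatten ps.
  by apply/flattenP; exists p' => //; apply/repP/(allP ps0).
by rewrite /= -eq_rep repP.
Qed.

Lemma path_cover_uniq ps M : path_cover ps M -> uniq (flatten ps).
Proof. by case=> _ /perm_uniq-> _; apply: enum_uniq. Qed.

Lemma card_lasts ps M : path_cover ps M -> #|lasts ps| = size ps.
Proof.
move=> cov; have [ne _ _] := cov.
have /card_uniqP := uniq_representatives last_mem ne (path_cover_uniq cov).
by rewrite size_map => <-; apply: eq_card => v; rewrite inE.
Qed.

Lemma card_heads ps M : path_cover ps M -> #|heads ps| = size ps.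
Proof.
move=> cov; have [ne _ _] := cov.
have /card_uniqP := uniq_representatives head_mem ne (path_cover_uniq cov).
by rewrite size_map => <-; apply: eq_card => v; rewrite inE.
Qed.

Lemma adjacent_sub M M' : M \subset M' -> subrel (adjacent M) (adjacent M').
Proof. by move=> sM x y; apply: (subsetP sM). Qed.

Lemma adjacent_sym M : symmetric (adjacent M).
Proof. by move=> x y; rewrite /adjacent /= setUC. Qed.

Lemma perm_path_cover ps ps' M : perm_eq ps ps' -> path_cover ps M -> path_cover ps' M.
Proof.
move=> pe [ne fl srt]; split; rewrite -?(perm_all _ pe) //.
by rewrite -(permPl (perm_flatten pe)).
Qed.

Lemma perm_lasts ps ps' : perm_eq ps ps' -> lasts ps = lasts ps'.
Proof. by move=> pe; apply/setP=> v; rewrite !inE (perm_mem (perm_map _ pe)). Qed.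

Lemma perm_heads ps ps' : perm_eq ps ps' -> heads ps = heads ps'.
Proof. by move=> pe; apply/setP=> v; rewrite !inE (perm_mem (perm_map _ pe)). Qed.

Lemma perm_closing ps ps' : perm_eq ps ps' -> closing_cells ps = closing_cells ps'.
Proof. by move=> pe; apply/setP=> v; rewrite !inE (perm_mem (perm_map _ pe)). Qed.

(** The path ending in [o] is prolonged by the path starting at [i]. All other closing cells
    persist, so the only new one pairs the last vertex of the second path with the head of the
    first. *)
Lemma join_paths ps M o i :
    path_cover ps M -> o \in lasts ps -> i \in heads ps ->
    (o, i) \notin closing_cells ps ->
  o != i /\ exists ps', [/\ path_cover ps' ([set o; i] |: M),
    lasts ps' = lasts ps :\ o, heads ps' = heads ps :\ i,
    size ps = (size ps').+1 & exists z, closing_cells ps' \subset z |: closing_cells ps].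
Proof.
move=> cov; rewrite !inE => /mapP[p1 p1ps oE] /mapP[p2 p2ps iE] oi.
have neq12 : p1 != p2.
  by apply: contraNneq oi => p12; apply/mapP; exists p1 => //; rewrite oE iE p12.
have pe : perm_eq ps (p1 :: p2 :: rem p2 (rem p1 ps)).
  apply: perm_trans (perm_to_rem p1ps) _; rewrite perm_cons.
  apply: perm_to_rem; move: p2ps; rewrite (perm_mem (perm_to_rem p1ps)) inE.
  by rewrite eq_sym (negPf neq12).
move: (rem p2 _) pe => qs pe; move: cov => /(perm_path_cover pe) cov.
rewrite (perm_lasts pe) (perm_heads pe) (perm_closing pe) (perm_size pe).
have [ne fl srt] := cov; have un := path_cover_uniq cov.
have [/= ne1 /andP[ne2 neq]] := andP ne.
have oi_neq : o != i.
  rewrite oE iE; apply: contraTneq un => eq12 /=.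
  rewrite cat_uniq negb_and orbC negb_and negbK; apply/orP; left; apply/orP; left.
  apply/hasP; exists (head x0 p2); first by rewrite mem_cat head_mem.
  by rewrite /= -eq12 last_mem.
split=> //; exists ((p1 ++ p2) :: qs).
have lastE : last x0 (p1 ++ p2) = last x0 p2.
  by case: p2 ne2 {neq12 p2ps iE pe cov ne fl srt un} => // x s _; rewrite last_cat.
have headE : head x0 (p1 ++ p2) = head x0 p1.
  by case: p1 ne1 {neq12 p1ps oE pe cov ne fl srt un lastE}.
split=> //.
- split; first by apply/andP; split=> //; case: (p1) ne1.
    by rewrite /= -catA.
  have := sub_all (fun p => sub_sorted (adjacent_sub (subsetUr [set [set o; i]] M)) (x := p)) srt.
  move=> /= /and3P[s1 s2 ->]; rewrite andbT.
  by apply: (@sorted_cat_edge _ x0) => //; rewrite -oE -iE /adjacent /= setU11.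
- have := uniq_representatives last_mem ne un; rewrite /= -oE => /andP[oN _].
  apply/setP=> v; rewrite !inE lastE -oE.
  by move: oN; rewrite inE; case: (eqVneq v o) => [->|] //= /negbTE.
- have := uniq_representatives head_mem ne un; rewrite /= -iE.
  rewrite inE negb_or -andbA => /and4P[i1 i2 iN _].
  apply/setP=> v; rewrite !inE headE -iE; case: (eqVneq v i) => [->|] //=.
  by rewrite eq_sym (negPf i1) (negPf iN).
- exists (last x0 p2, head x0 p1); apply/subsetP=> z.
  rewrite !inE lastE headE => /orP[->//|->]; by rewrite !orbT.
Qed.

End PathCovers.

(** * Rounds joining two paths *)

Section Rounds.
Import Order.TTheory GRing.Theory Num.Theory.
Local Open Scope ring_scope.

Variables (V : finType) (x0 : V) (R : realFieldType) (b : nat).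

Implicit Types (ps : seq (seq V)) (M G F : {set {set V}}) (X : R).

Local Notation board := (complete_graph V).
Local Notation lasts := (lasts x0).
Local Notation heads := (heads x0).
Local Notation forbidden := (forbidden x0).

Lemma edge_cellsU G1 G2 : edge_cells (G1 :|: G2) = edge_cells G1 :|: edge_cells G2.
Proof. by apply/setP=> z; rewrite !inE. Qed.

Lemma card_edge_cells F : F \subset board -> (#|edge_cells F| <= 2 * #|F|)%N.
Proof.
move=> sF; have -> : edge_cells F = \bigcup_(e in F) edge_cells [set e].
  apply/setP=> z; rewrite inE; apply/idP/bigcupP => [zF|[e eF]].
    by exists [set z.1; z.2] => //; rewrite !inE.
  by rewrite !inE => /eqP ->.
have le_sum : (\sum_(e in F) #|edge_cells [set e]| <= \sum_(e in F) 2)%N.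
  apply: leq_sum => e eF; have := subsetP sF e eF.
  rewrite /complete_graph in_set => /cards2P[x [y [xy ->]]].
  apply: (@leq_trans #|[set (x, y); (y, x)]|); last first.
    by rewrite cards2; case: (_ != _).
  apply/subset_leq_card/subsetP=> -[u v]; rewrite !inE /= => /eqP/setP eqs.
  have := eqs u; have := eqs x; have := eqs y.
  rewrite !inE !xpair_eqE !eqxx orbT /= => hy hx /esym/orP[/eqP uE|/eqP uE]; subst u.
    by rewrite [y == x]eq_sym (negPf xy) /= in hy; move/eqP: hy => <-; rewrite !eqxx.
  by rewrite (negPf xy) /= in hx; move/eqP: hx => <-; rewrite !eqxx orbT.
apply: leq_trans (_ : \sum_(e in F) #|edge_cells [set e]| <= 2 * #|F|)%N; last first.
  by rewrite mulnC -sum_nat_const.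
elim/big_rec2: _ => [|e s A _ IH]; first by rewrite cards0.
by apply: leq_trans (leq_card_setU _ _) _; rewrite leq_add2l.
Qed.

(* [Fb] may lag behind the forbidden cells by [e].  A move of Maker forbids at
   most 3 new cells and a move of Breaker at most [2 b]; a relieving round
   followed by a balancing one thus lets [3 + 2 b + 3 + 2 b = 4 b + 6] cells
   accumulate, which is the tolerance of [choose_cell]. *)
Definition cover_state ps M G X e :=
  [/\ path_cover ps M, M \subset G /\ G \subset board &
   exists2 Fb, potential R (128 * (4 * b + 6)) (lasts ps) (heads ps) Fb <= X &
     (#|(forbidden ps G :\: Fb) :&: setX (lasts ps) (heads ps)| <= e)%N].

Lemma forbidden_increase ps G F : F \subset board ->
  (#|forbidden ps (G :|: F) :\: forbidden ps G| <= 2 * #|F|)%N.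
Proof.
move=> sF; apply: leq_trans (card_edge_cells sF).
apply/subset_leq_card/subsetP=> z; rewrite !inE.
by case: (z \in _) => //=; case: (_ \in G).
Qed.

(** [choose_cell] compares nested sets, so the current forbidden cells enter it as their union with
    the outdated set [Fb]. *)
Lemma forbidden_extra ps G F Fb e : F \subset board -> (#|F| <= b)%N ->
    (#|(forbidden ps G :\: Fb) :&: setX (lasts ps) (heads ps)| <= e)%N ->
  (#|((Fb :|: forbidden ps (G :|: F)) :\: Fb) :&: setX (lasts ps) (heads ps)|
     <= e + 2 * b)%N.
Proof.
move=> sF cF ce.
have sub : ((Fb :|: forbidden ps (G :|: F)) :\: Fb) :&: setX (lasts ps) (heads ps)
  \subset ((forbidden ps G :\: Fb) :&: setX (lasts ps) (heads ps))
    :|: (forbidden ps (G :|: F) :\: forbidden ps G).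
  move: (forbidden ps (G :|: F)) (forbidden ps G) => f2 f1; apply/subsetP=> z.
  rewrite !(in_setI, in_setD, in_setU, in_setX).
  by case: (z \in Fb); case: (z \in f2); case: (z \in f1); case: (z \in setX _ _).
apply: leq_trans (subset_leq_card sub) _; apply: leq_trans (leq_card_setU _ _) _.
rewrite leq_add //; apply: leq_trans (forbidden_increase _ _ sF) _.
by rewrite leq_mul2l cF.
Qed.

Lemma join_round ps M G F o i :
    path_cover ps M -> M \subset G -> G \subset board -> F \subset board :\: G ->
    o \in lasts ps -> i \in heads ps -> (o, i) \notin forbidden ps (G :|: F) ->
  [set o; i] \in board :\: (G :|: F) /\ exists ps',
  [/\ path_cover ps' ([set o; i] |: M),
    [set o; i] |: M \subset [set o; i] |: (G :|: F) /\ [set o; i] |: (G :|: F) \subset board,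
    lasts ps' = lasts ps :\ o /\ heads ps' = heads ps :\ i,
    size ps = (size ps').+1 &
    (#|forbidden ps' ([set o; i] |: (G :|: F)) :\: forbidden ps (G :|: F)| <= 3)%N].
Proof.
move=> cov sMG sGb sF oL iH; rewrite inE negb_or => /andP[ndiag nedge].
have [neq [ps' [cov' lE hE sz [z sz']]]] := join_paths cov oL iH ndiag.
have eb : [set o; i] \in board by rewrite inE cards2 neq.
split; first by rewrite inE eb andbT; rewrite inE in nedge.
exists ps'; split=> //.
  split; first by rewrite setUS // subsetU // sMG.
  by move: sF; rewrite subsetD !subUset sub1set eb sGb => /andP[->].
(* The 3 new cells are one closing cell and the two orientations of Maker's edge. *)
have sub : forbidden ps' ([set o; i] |: (G :|: F)) :\: forbidden ps (G :|: F)
   \subset [set z] :|: edge_cells [set [set o; i]].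
  rewrite /forbidden (edge_cellsU [set [set o; i]]).
  move: (edge_cells (G :|: F)) (edge_cells [set [set o; i]]) => E E1.
  apply/subsetP=> y; rewrite in_setD => /andP[+]; rewrite !in_setU.
  rewrite negb_or => /andP[yc ye] /orP[/(subsetP sz')|].
    by rewrite in_setU (negPf yc) orbF => ->.
  by rewrite (negPf ye) orbF => ->; rewrite orbT.
apply: leq_trans (subset_leq_card sub) _; apply: leq_trans (leq_card_setU _ _) _.
rewrite cards1 (@leq_add 1 _ 1 2) //; apply: leq_trans (card_edge_cells _) _.
  by rewrite sub1set.
by rewrite cards1.
Qed.

(** The size conditions of [choose_cell] for [c = 4 b + 6] and [a = 128 c]. *)
Definition large_cover m :=
  (40 * (128 * (4 * b + 6)) <= m)%N /\
  m%:R + 3 <= base R (128 * (4 * b + 6)) ^+ (m - (4 * b + 6)).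

Lemma scale_gt0 : (0 < 128 * (4 * b + 6))%N.
Proof. by lia. Qed.

(** The potential is brought up to date with Breaker's move, so only the 3 cells spoilt by Maker's
    own move still lag behind. *)
Lemma balancing_round ps M G X e F :
    cover_state ps M G X e -> (e + 2 * b <= 4 * b + 6)%N -> large_cover (size ps) ->
    (size ps)%:R / 2 <= X <= (size ps)%:R / 2 + 1 / 2 ->
    F \subset board :\: G -> (#|F| <= b)%N ->
  exists2 f, f \in board :\: (G :|: F) & exists ps',
   [/\ cover_state ps' (f |: M) (f |: (G :|: F)) (X - 2 / 3) 3,
       lasts ps' \subset lasts ps, heads ps' \subset heads ps &
       size ps = (size ps').+1].
Proof.
move=> [cov [sMG sGb] [Fb potX ce]] le_c [m40 mbig] Xm sF cF.
have sFb : F \subset board by move: sF; rewrite subsetD => /andP[].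
have cE := forbidden_extra sFb cF ce.
have [o [i [oL iH oiF potX']]] := choose_cell scale_gt0 erefl (card_lasts x0 cov)
  (card_heads x0 cov) (subsetUl Fb (forbidden ps (G :|: F))) (leq_trans cE le_c)
  m40 mbig potX Xm.
have oiF' : (o, i) \notin forbidden ps (G :|: F).
  by apply: contraNN oiF => h; rewrite inE h orbT.
have [fb [ps' [cov' [sMG' sGb'] [lE hE] sz c3]]] := join_round cov sMG sGb sF oL iH oiF'.
exists [set o; i] => //; exists ps'; split=> //; last first.
- by rewrite hE subsetDl.
- by rewrite lE subsetDl.
split=> //; exists (Fb :|: forbidden ps (G :|: F)); first by rewrite lE hE.
apply: leq_trans c3; apply/subset_leq_card; apply: subset_trans (subsetIl _ _) _.
by rewrite setDS // subsetUr.
Qed.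

Lemma potential_delete (O I : {set V}) (Fb : {set V * V}) o i a : (0 < a)%N ->
    o \in O -> i \in I -> (o, i) \notin Fb ->
  potential R a (O :\ o) (I :\ i) Fb <= potential R a O I Fb.
Proof.
move=> a0 oO iI oiF; apply: le_trans (potential_remove R a0 oO iI oiF) _.
by rewrite -addrA -opprD gerBl addr_ge0 ?gain_ge0.
Qed.

(** No line is full, so any prescribed end [v] has an allowed partner. If [v] is a head, the partner
    is found on the transposed board. *)
Lemma free_cell ps M G X e F v :
    cover_state ps M G X e -> (e + 2 * b <= 4 * b + 6)%N -> large_cover (size ps) ->
    X <= (size ps)%:R / 2 + 1 / 2 -> v \in lasts ps :|: heads ps ->
    F \subset board -> (#|F| <= b)%N ->
  exists o i, [/\ o \in lasts ps, i \in heads ps, v \in [set o; i],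
    (o, i) \notin forbidden ps (G :|: F) & exists2 Fb : {set V * V}, (o, i) \notin Fb &
     potential R (128 * (4 * b + 6)) (lasts ps) (heads ps) Fb <= X /\
     (#|(forbidden ps (G :|: F) :\: Fb) :&: setX (lasts ps) (heads ps)| <= e + 2 * b)%N].
Proof.
move=> [cov _ [Fb potX ce]] le_c [m40 mbig] Xm vLH sFb cF.
have cE := forbidden_extra sFb cF ce; have cE' := leq_trans cE le_c.
have sub := subsetUl Fb (forbidden ps (G :|: F)).
have cE'' : (#|(forbidden ps (G :|: F) :\: Fb) :&: setX (lasts ps) (heads ps)| <= e + 2 * b)%N.
  by apply: leq_trans cE; apply/subset_leq_card; rewrite setSI // setSD // subsetUr.
move: vLH; rewrite inE => /orP[vL|vH].
  have [i [iH + _]] := choose_partner scale_gt0 sub vL cE' (card_heads x0 cov) mbig potX Xm.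
  rewrite inE negb_or => /andP[viFb viF].
  exists v; exists i; split=> //; first by rewrite !inE eqxx.
  by exists Fb.
have sub' : swap Fb \subset swap (Fb :|: forbidden ps (G :|: F)).
  by apply/subsetP=> z; rewrite !inE => ->.
have cEs : (#|(swap (Fb :|: forbidden ps (G :|: F)) :\: swap Fb) :&: setX (heads ps) (lasts ps)| <= 4 * b + 6)%N.
  rewrite -card_swap; apply: leq_trans cE'; apply/subset_leq_card/subsetP=> -[x y].
  by rewrite !inE /= [(_ \in [seq head x0 _ | _ <- _]) && _]andbC.
have [o [oL + _]] := choose_partner scale_gt0 sub' vH cEs (card_lasts x0 cov) mbig
  (eq_ind_r (fun y => y <= X) potX (potentialC _ _ _ _ _)) Xm.
rewrite inE inE negb_or => /andP[viFb viF].
exists o; exists v; split=> //; first by rewrite !inE eqxx orbT.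
by exists Fb.
Qed.

(** Here [Fb] is kept: deleting lines cannot raise the potential, so [X] survives while the lag
    grows by the cells of this round. *)
Lemma relieving_round ps M G X e F v :
    cover_state ps M G X e -> (e + 2 * b <= 4 * b + 6)%N -> large_cover (size ps) ->
    X <= (size ps)%:R / 2 + 1 / 2 -> v \in lasts ps :|: heads ps ->
    F \subset board :\: G -> (#|F| <= b)%N ->
  exists2 f, f \in board :\: (G :|: F) & exists ps',
   [/\ cover_state ps' (f |: M) (f |: (G :|: F)) X (e + 2 * b + 3),
       lasts ps' \subset lasts ps, heads ps' \subset heads ps,
       size ps = (size ps').+1 &
       (v \in lasts ps :\: lasts ps') || (v \in heads ps :\: heads ps')].
Proof.
move=> st le_c big Xm vLH sF cF.
have sFb : F \subset board by move: sF; rewrite subsetD => /andP[].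
have [o [i [oL iH voi oiF [Fb oiFb [potX cE]]]]] := free_cell st le_c big Xm vLH sFb cF.
have [cov [sMG sGb] _] := st.
have [fb [ps' [cov' [sMG' sGb'] [lE hE] sz c3]]] := join_round cov sMG sGb sF oL iH oiF.
exists [set o; i] => //; exists ps'; split=> //.
- split=> //; exists Fb; first by rewrite lE hE; apply: le_trans potX; apply: potential_delete => //; apply: scale_gt0.
  set G' := _ |: (_ :|: _).
  have sub : (forbidden ps' G' :\: Fb) :&: setX (lasts ps') (heads ps')
     \subset ((forbidden ps (G :|: F) :\: Fb) :&: setX (lasts ps) (heads ps))
       :|: (forbidden ps' G' :\: forbidden ps (G :|: F)).
    move: (forbidden ps' G') (forbidden ps (G :|: F)) => f2 f1.
    apply/subsetP=> -[u w]; rewrite lE hE !in_setU !in_setI !in_setD !in_setX !in_setD.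
    move=> /andP[/andP[-> ->] /andP[/andP[_ ->] /andP[_ ->]]]; rewrite !andbT.
    exact: orbN.
  by apply: leq_trans (subset_leq_card sub) _; apply: leq_trans (leq_card_setU _ _) _; rewrite leq_add.
- by rewrite lE subsetDl.
- by rewrite hE subsetDl.
rewrite lE hE !in_setD !in_set1 !negb_and !negbK; move: voi; rewrite in_set2.
by case/orP=> /eqP ->; rewrite ?oL ?iH eqxx ?orbT.
Qed.

End Rounds.

(** * Reducing the number of paths *)

Section Degrees.

Variable V : finType.
Implicit Types (G F : {set {set V}}) (v : V).

Definition nbrs G v : {set V} := [set w | [set v; w] \in G].
Definition deg G v : nat := #|nbrs G v|.

Lemma set2_inj v : injective (fun w => [set v; w]).
Proof.
move=> w w' /setP eqs; have := eqs w; have := eqs w'.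
rewrite !inE !eqxx !orbT => /orP[/eqP vE|/eqP //] /esym/orP[/eqP|/eqP //].
by rewrite vE.
Qed.

Lemma deg_growth G G' v : deg G' v <= deg G v + #|G' :\: G|.
Proof.
have sub : nbrs G' v \subset nbrs G v :|: [set w | [set v; w] \in G' :\: G].
  by apply/subsetP=> w; rewrite !inE => ->; rewrite andbT orbN.
apply: leq_trans (subset_leq_card sub) _; apply: leq_trans (leq_card_setU _ _) _.
rewrite leq_add2l -(card_imset _ (@set2_inj v)); apply/subset_leq_card/subsetP=> e.
by case/imsetP=> w; rewrite inE => wG ->.
Qed.

Lemma deg_le G G' v : G \subset G' -> deg G v <= deg G' v.
Proof.
by move=> sG; apply/subset_leq_card/subsetP=> w; rewrite !inE; apply: (subsetP sG).
Qed.

Definition heavy k G : {set V} := [set v | k <= deg G v].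

(** The degree sum counts each claimed edge at most twice. *)
Lemma card_heavy k G : G \subset complete_graph V -> #|heavy k G| * k <= 2 * #|G|.
Proof.
move=> sG; apply: leq_trans (card_edge_cells sG).
have -> : #|edge_cells G| = \sum_v deg G v.
  rewrite -sum1_card; under [RHS]eq_bigr => v _ do rewrite /deg -sum1_card.
  by rewrite pair_big_dep /=; apply: eq_bigl => -[o i]; rewrite !inE.
rewrite -sum_nat_const big_mkcond /=; apply: leq_sum => v _.
by rewrite inE; case: ifP.
Qed.

Lemma heavyS k G G' : G \subset G' -> heavy k G \subset heavy k G'.
Proof.
by move=> sG; apply/subsetP=> v; rewrite !inE => /leq_trans; apply; apply: deg_le.
Qed.

End Degrees.

(** * The covering stage *)

Section Covering.
Import Order.TTheory GRing.Theory Num.Theory.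
Local Open Scope ring_scope.

Variables (V : finType) (x0 : V) (R : realFieldType) (b theta M0 : nat).
Hypothesis large : forall m, (M0 <= m)%N -> large_cover R b m.

Implicit Types (ps : seq (seq V)) (M G F : {set {set V}}) (X : R).

Local Notation board := (complete_graph V).
Local Notation lasts := (lasts x0).
Local Notation heads := (heads x0).

(* Increases with every relieving round spent on a heavy vertex, yet is at most
   twice the number of heavy vertices; this bounds how long an active vertex
   can stay heavy. *)
Definition relieved ps G :=
  (#|heavy theta G :\: lasts ps| + #|heavy theta G :\: heads ps|)%N.

Lemma relieved_le ps ps' G G' : lasts ps' \subset lasts ps -> heads ps' \subset heads ps ->
  G \subset G' -> (relieved ps G <= relieved ps' G')%N.
Proof.
by move=> sl sh sG; rewrite leq_add //; apply/subset_leq_card/setDSS => //; apply: heavyS.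
Qed.

Lemma relieved_lt ps ps' G G' v : lasts ps' \subset lasts ps -> heads ps' \subset heads ps ->
    G \subset G' -> v \in heavy theta G' ->
    (v \in lasts ps :\: lasts ps') || (v \in heads ps :\: heads ps') ->
  (relieved ps G < relieved ps' G')%N.
Proof.
move=> sl sh sG vh /orP[]; rewrite in_setD => /andP[vN vI].
- rewrite /relieved -addSn leq_add //; last by apply/subset_leq_card/setDSS => //; apply: heavyS.
  apply: proper_card; apply/properP; split; first by apply: setDSS => //; apply: heavyS.
  by exists v; rewrite in_setD ?vN // vI.
- rewrite /relieved -addnS leq_add //; first by apply/subset_leq_card/setDSS => //; apply: heavyS.
  apply: proper_card; apply/properP; split; first by apply: setDSS => //; apply: heavyS.
  by exists v; rewrite in_setD ?vN // vI.
Qed.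

Definition descends ps ps' k :=
  [/\ lasts ps' \subset lasts ps, heads ps' \subset heads ps &
      size ps = (size ps' + k)%N].

Lemma descends_trans ps1 ps2 ps3 k l :
  descends ps1 ps2 k -> descends ps2 ps3 l -> descends ps1 ps3 (k + l).
Proof.
move=> [s1 t1 z1] [s2 t2 z2]; split.
- exact: subset_trans s1.
- exact: subset_trans t1.
- by rewrite z1 z2; lia.
Qed.

(** With [k] rounds to go, [X] exceeds half the number of paths by [k / 6], which for [k <= 3] stays
    within the window of [choose_cell]. *)
Lemma balancing_reach k ps M G X e m :
    cover_state x0 b ps M G X e -> (e + 2 * b <= 4 * b + 6)%N ->
    size ps = (m + k)%N -> (M0 <= m)%N ->
    X = m%:R / 2 + k%:R * (2 / 3) -> (k <= 3)%N ->
  reach board b k (fun M' G' => exists2 ps',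
    exists e', cover_state x0 b ps' M' G' (m%:R / 2 : R) e' /\
               (e' <= if k == 0%N then e else 3)%N
    & descends ps ps' k) M G.
Proof.
elim: k ps M G X e => [|k IHk] ps M G X e st le_e sz le_m XE k3.
  apply: reach_now; exists ps; last by split=> //; rewrite addn0.
  by exists e; split=> //; rewrite XE mul0r addr0 in st.
apply: reach_step => F sF cF.
have Xm : (size ps)%:R / 2 <= X <= (size ps)%:R / 2 + 1 / 2.
  rewrite sz XE natrD -natr1.
  have : k%:R <= 2 :> R by rewrite (ler_nat R k 2).
  have : 0 <= k%:R :> R by [].
  by move=> *; apply/andP; split; lra.
have [|f fb [ps' [st' sl sh sz']]] := balancing_round st le_e (large _) Xm sF cF.
  by rewrite sz; lia.
exists f => //.
have XE' : X - 2 / 3 = m%:R / 2 + k%:R * (2 / 3) by rewrite XE -natr1; lra.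
have sz'' : size ps' = (m + k)%N by lia.
have le3 : (3 + 2 * b <= 4 * b + 6)%N by lia.
have := IHk ps' _ _ _ 3%N st' le3 sz'' le_m XE' (ltnW k3).
apply: reach_sub => M' G' [ps'' [e' [st'' le_e']] d']; exists ps''.
  by exists e'; split=> //; apply: leq_trans le_e' _; case: ifP.
have d1 : descends ps ps' 1 by split=> //; rewrite addn1.
exact: descends_trans d1 d'.
Qed.

(** Each round merges two paths and claims at most [b + 1] edges, whence the second clause. In the
    third, a block of four rounds raises a degree by at most [4 (b + 1)], and every block that
    starts with a heavy path end increases [relieved]. *)
Definition covering_invariant ps M G :=
  [/\ cover_state x0 b ps M G ((size ps)%:R / 2 : R) 3,
      (#|G| + b.+1 * size ps <= b.+1 * #|V|)%N &
      forall v, v \in lasts ps :|: heads ps ->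
        (deg G v <= theta + 4 * b.+1 * (relieved ps G).+1)%N].

(** One relieving round leaves [X] as it is, and three balancing rounds lower it by 2 in all:
    exactly half of the four paths lost. *)
Lemma invariant_step ps M G : covering_invariant ps M G -> (M0 + 4 <= size ps)%N ->
  reach board b 4 (fun M' G' => exists2 ps', covering_invariant ps' M' G' &
                     size ps = (size ps' + 4)%N) M G.
Proof.
move=> [st cG dG] szM; have [cov [sMG sGb] _] := st.
suff re : reach board b 4 (fun M' G' => exists ps',
    [/\ cover_state x0 b ps' M' G' ((size ps')%:R / 2 : R) 3, descends ps ps' 4 &
      (forall v, v \in lasts ps :|: heads ps -> (deg G v < theta)%N) \/
      (relieved ps G < relieved ps' G')%N]) M G.
  apply: reach_sub (reach_growth sMG sGb re) => M' G' [[ps' [st' [sl sh sz] rel]] sM sG _ c'].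
  exists ps' => //; split=> //.
    have cG' : (#|G'| <= #|G| + #|G' :\: G|)%N.
      by rewrite -(cardsID G G') leq_add2r subset_leq_card // subsetIr.
    by move: cG; rewrite sz; clear -c' cG'; lia.
  move=> v vLH'; have vLH : v \in lasts ps :|: heads ps by apply: (subsetP (setUSS sl sh)).
  have dv := deg_growth G G' v.
  case: rel => [/(_ v vLH) rel|rel]; first by clear -rel dv c'; lia.
  have := dG v vLH.
  have : (b.+1 * (relieved ps G).+2 <= b.+1 * (relieved ps' G').+1)%N by apply: leq_mul.
  by rewrite -!mulnA; clear -dv c'; lia.
have sz0 : (0 < size ps)%N by clear -szM; lia.
have X0 : (size ps)%:R / 2 <= (size ps)%:R / 2 + 1 / 2 :> R by lra.
have XE : (size ps)%:R / 2 = (size ps - 4)%:R / 2 + 3%:R * (2 / 3) :> R.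
  by rewrite natrB; [lra|clear -szM; lia].
apply: (@reach_step _ _ _ 3) => F sF cF.
(* Heaviness is tested after Breaker's reply. If no path end is heavy, any end may be relieved,
   since all degrees then restart from below [theta]. *)
have [v vLH vP] : exists2 v, v \in lasts ps :|: heads ps &
   (theta <= deg (G :|: F) v)%N \/
   forall u, u \in lasts ps :|: heads ps -> (deg (G :|: F) u < theta)%N.
  case: (pickP [pred v | (v \in lasts ps :|: heads ps) && (theta <= deg (G :|: F) v)%N]).
    by move=> v /andP[vLH vh]; exists v => //; left.
  move=> light; have /card_gt0P[v vL] : (0 < #|lasts ps|)%N by rewrite (card_lasts x0 cov).
  exists v; first by rewrite in_setU vL.
  by right=> u uLH; have := light u; rewrite /= uLH /= ltnNge => ->.
have le1 : (3 + 2 * b <= 4 * b + 6)%N by clear; lia.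
have lg : large_cover R b (size ps) by apply: large; clear -szM; lia.
have [f fb [ps1 [st1 sl sh sz v1]]] := relieving_round st le1 lg X0 vLH sF cF.
exists f => //.
have le2 : (3 + 2 * b + 3 + 2 * b <= 4 * b + 6)%N by clear; lia.
have sz1 : size ps1 = ((size ps - 4) + 3)%N by clear -szM sz; lia.
have le_m : (M0 <= size ps - 4)%N by clear -szM; lia.
have re := balancing_reach st1 le2 sz1 le_m XE (leqnn 3).
have [_ [sMG1 sGb1] _] := st1.
apply: reach_sub (reach_growth sMG1 sGb1 re) => M' G' [[ps' [e' [st' le_e'] d]] sM sG _ _].
exists ps'; split.
- have -> : size ps' = (size ps - 4)%N by case: d => _ _; rewrite sz1 => /addIn.
  case: st' => cov' sMG' [Fb pot ce]; split=> //; exists Fb => //.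
  exact: leq_trans ce le_e'.
- have d1 : descends ps ps1 1 by split=> //; rewrite addn1.
  exact: descends_trans d1 d.
- case: d => sl' sh' _; case: vP => [vh|light]; [right|left].
    have sGG1 : G \subset f |: (G :|: F) by rewrite setUA subsetU // subsetUr.
    apply: leq_trans (relieved_le sl' sh' sG).
    apply: relieved_lt v1 => //; rewrite inE; apply: leq_trans vh _.
    by apply: deg_le; rewrite subsetUr.
  move=> u uLH; apply: leq_ltn_trans (light u uLH).
  by apply: deg_le; rewrite subsetUl.
Qed.

Lemma invariant_loop ps M G : covering_invariant ps M G -> (M0 <= size ps)%N ->
  reach board b (size ps - M0) (fun M' G' => exists2 ps', covering_invariant ps' M' G' &
                     (M0 <= size ps' < M0 + 4)%N) M G.
Proof.
move: {2}(size ps).+1 (ltnSn (size ps)) => k.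
elim: k ps M G => // k IHk ps M G szk inv leM.
have [lt4|ge4] := ltnP (size ps) (M0 + 4).
  by apply: reach_now; exists ps => //; rewrite leM.
have -> : (size ps - M0 = 4 + (size ps - 4 - M0))%N by lia.
apply: reach_bind (invariant_step inv ge4) _ => M' G' [ps' inv' sz].
have -> : (size ps - 4 - M0 = size ps' - M0)%N by lia.
by apply: IHk => //; lia.
Qed.

Definition singletons : seq (seq V) := [seq [:: v] | v <- enum V].

Lemma invariant_start : covering_invariant singletons set0 set0.
Proof.
have flE : flatten singletons = enum V.
  by rewrite /singletons; elim: (enum V) => //= v s ->.
have lastsE : lasts singletons = [set: V].
  by apply/setP=> v; rewrite !inE -map_comp map_id mem_enum.
have headsE : heads singletons = [set: V].
  by apply/setP=> v; rewrite !inE -map_comp map_id mem_enum.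
have diagE : closing_cells x0 singletons = [set z : V * V | z.1 == z.2].
  apply/setP=> -[u v]; rewrite !inE -map_comp /=.
  apply/mapP/eqP => [[w _ [-> ->]] //|->]; by exists v; rewrite ?mem_enum.
have cov : path_cover singletons set0.
  split; last by apply/allP=> p /mapP[v _ ->].
    by apply/allP=> p /mapP[v _ ->].
  by rewrite flE.
split; last 2 first.
- by rewrite cards0 add0n size_map -cardE.
- move=> v _; have -> : deg set0 v = 0%N by apply: eq_card0 => w; rewrite !inE.
  by [].
split; [by []| by rewrite !sub0set |].
exists (closing_cells x0 singletons); last first.
  rewrite (_ : _ :&: _ = set0) ?cards0 //; apply/setP=> z.
  by rewrite /forbidden !inE; case: (z \in _).
(* At the start only the diagonal is forbidden: each line has degree 1 and weight [1 / a <= 1 / 4],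
   and rows and columns together give half the number of paths. *)
have row1 (D : {set V * V}) : D = [set z | z.1 == z.2] ->
    rows R (128 * (4 * b + 6)) [set: V] [set: V] D <= (size singletons)%:R / 4.
  move=> DE; rewrite /rows size_map -cardE -[#|V|]cardsT [_%:R / 4]mulr_natl -sumr_const.
  apply: ler_sum => o _; have -> : row_deg [set: V] D o = 1%N.
    by rewrite /row_deg -(cards1 o); apply: eq_card => i; rewrite DE !inE eq_sym.
  by rewrite /weight expr1 /base [1 + _]addrC addrK lef_pV2 ?posrE ?ltr0n ?(ler_nat R 4); clear; lia.
rewrite lastsE headsE /potential.
have h1 := row1 _ diagE; have h2 : swap (closing_cells x0 singletons) = [set z | z.1 == z.2].
  by rewrite diagE; apply/setP=> z; rewrite !inE eq_sym.
by have := row1 _ h2; move: h1; lra.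
Qed.

End Covering.

(** * Linking two vertices *)

Section Linking.

Variables (V : finType) (b : nat).

Implicit Types (M G F : {set {set V}}) (A B X Y : {set V}).

Local Notation board := (complete_graph V).

(** The edges that would complete a surgery once one path end is joined to [x] and the other to [y].
    [phi] and [psi] are the predecessor and successor maps on a path to be closed, and both are
    [next] on a cycle. *)
Definition links (phi psi : V -> V) A B : {set {set V}} :=
  [set [set phi x; psi y] | x in A, y in B].

Lemma card_bigcup_le (I : finType) (A : {set I}) (D : I -> {set V}) d :
  (forall x, x \in A -> #|D x| <= d) -> #|\bigcup_(x in A) D x| <= #|A| * d.
Proof.
move=> leD; rewrite -sum_nat_const.
apply: leq_trans (_ : \sum_(x in A) #|D x| <= _); last exact: leq_sum.
elim/big_rec2: _ => [|x s U _ IH]; first by rewrite cards0.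
by apply: leq_trans (leq_card_setU _ _) _; rewrite leq_add2l.
Qed.

Lemma card_light X (phi : V -> V) (N : {set V}) : {in X &, injective phi} ->
  #|X| <= #|[set x in X | phi x \notin N]| + #|N|.
Proof.
move=> inj; rewrite -(cardsID [set x | phi x \in N]) addnC leq_add //.
  by apply/subset_leq_card/subsetP=> x; rewrite !inE => /andP[-> ->].
rewrite -(card_in_imset (f := phi)).
  by apply/subset_leq_card/subsetP=> z /imsetP[x]; rewrite !inE => /andP[_ xN] ->.
by move=> x y /setIP[xX _] /setIP[yX _]; apply: inj.
Qed.

Lemma linksU1 (phi psi : V -> V) A B y :
  links phi psi A (y |: B) \subset links phi psi A B :|: [set [set phi x; psi y] | x in A].
Proof.
apply/subsetP=> e /imset2P[x z xA]; rewrite in_setU1 in_setU => /orP[/eqP ->|zB] ->.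
  by apply/orP; right; apply/imsetP; exists x.
by apply/orP; left; apply/imset2P; exists x z.
Qed.

(** A new [y] is chosen so that all its links to [A] are free at that moment. Only edges claimed
    during the fan can therefore spoil links, at most [b + 1] per round. *)
Lemma fan phi psi q A Y d k M G :
    M \subset G -> G \subset board -> q \notin Y -> {in Y &, injective psi} ->
    (forall x, x \in A -> deg G (phi x) <= d) ->
    deg G q + b.+1 * k + #|A| * (d + b.+1 * k) < #|Y| ->
  reach board b k (fun M' G' => exists2 B : {set V},
      [/\ B \subset Y, #|B| = k & forall y, y \in B -> [set q; y] \in M'] &
      #|links phi psi A B :&: G'| <= b.+1 * k) M G.
Proof.
move=> sMG sGb qY psi_inj; elim: k => [|k IHk] degA big.
  apply: reach_now; exists set0.
    by split; rewrite ?sub0set ?cards0 // => y; rewrite inE.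
  rewrite muln0 (_ : _ :&: _ = set0) ?cards0 //; apply/setP=> e; rewrite !inE.
  by apply/andP=> -[/imset2P[x y _]]; rewrite inE.
have big' : deg G q + b.+1 * k + #|A| * (d + b.+1 * k) < #|Y|.
  apply: leq_ltn_trans big; rewrite leq_add ?leq_add2l ?leq_mul2l ?leqnSn ?orbT //.
  by rewrite leq_add2l leq_mul2l leqnSn !orbT.
rewrite -[k.+1]addn1.
apply: reach_bind (reach_growth sMG sGb (IHk degA big')) _.
move=> M' G' [[B [sBY cB qB] cE] sM sG [sMG' sGb'] cG].
apply: (@reach_step _ _ _ 0) => F sF cF.
have cGF : #|(G' :|: F) :\: G| <= b.+1 * k + b.
  rewrite setDUl; apply: leq_trans (leq_card_setU _ _) (leq_add cG _).
  by apply: leq_trans cF; apply/subset_leq_card; rewrite subsetDl.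
have degGF v : deg (G' :|: F) v <= deg G v + (b.+1 * k + b).
  by apply: leq_trans (deg_growth G _ v) _; rewrite leq_add2l.
(* [N] consists of the endpoints of claimed edges at the vertices [phi x]; keeping [psi y] outside
   [N] makes the links of [y] free. *)
pose N := \bigcup_(x in A) nbrs (G' :|: F) (phi x).
have cN : #|N| <= #|A| * (d + b.+1 * k.+1).
  apply: card_bigcup_le => x xA; apply: leq_trans (degGF (phi x)) _.
  by rewrite leq_add ?degA // mulnS; clear; lia.
have [y yY] : exists2 y, y \in Y & (psi y \notin N) && ([set q; y] \notin G' :|: F).
  have cY := card_light N psi_inj.
  have : 0 < #|[set x in Y | psi x \notin N] :\: nbrs (G' :|: F) q|.
    have := cardsID (nbrs (G' :|: F) q) [set x in Y | psi x \notin N].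
    have : #|[set x in Y | psi x \notin N] :&: nbrs (G' :|: F) q| <= deg (G' :|: F) q.
      by apply/subset_leq_card/subsetIr.
    have := degGF q; move: big cN cY; rewrite !mulnS; clear; lia.
  case/card_gt0P=> y; rewrite !inE => /andP[qy /andP[yY yN]].
  by exists y => //; rewrite yN in_setU.
move=> /andP[yN qy].
exists [set q; y].
  by rewrite in_setD qy inE cards2 (_ : q != y) //; apply: contraNneq qY => ->.
have yB : y \notin B.
  by apply: contraNN qy => /qB qyM; rewrite inE (subsetP sMG').
apply: reach_now; exists (y |: B).
  split; first by rewrite subUset sub1set yY.
    by rewrite cardsU1 yB cB addnC.
  by move=> z; rewrite !inE => /orP[/eqP ->|/qB ->]; rewrite ?eqxx ?orbT.
have sub : links phi psi A (y |: B) :&: ([set q; y] |: (G' :|: F)) \subset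
    (links phi psi A B :&: G') :|: ([set q; y] |: F).
  apply/subsetP=> e; rewrite in_setI => /andP[/(subsetP (linksU1 _ _ _ _ _))].
  rewrite !in_setU in_setI !in_set1 => /orP[->|/imsetP[x xA eE]].
    by case: (e == _); case: (e \in G'); case: (e \in F).
  have -> : e \in G' = false.
    apply: contraNF yN => eG; apply/bigcupP; exists x => //.
    by rewrite !inE -eE eG.
  by rewrite andbF.
apply: leq_trans (subset_leq_card sub) _; apply: leq_trans (leq_card_setU _ _) _.
rewrite addn1 mulnS addnC leq_add // cardsU1; apply: leq_trans (leq_add (leq_b1 _) cF) _.
by rewrite add1n.
Qed.

Lemma card_links phi psi A B : {in A &, injective phi} -> {in B &, injective psi} ->
    (forall x y, x \in A -> y \in B -> phi x != psi y) ->
  #|links phi psi A B| = #|A| * #|B|.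
Proof.
move=> phi_inj psi_inj neq; rewrite /links curry_imset2X card_in_imset ?cardsX //.
move=> [x y] [x' y'] /setXP[/= xA yB] /setXP[/= x'A y'B] /setP eqs.
have := eqs (phi x); have := eqs (psi y); rewrite !inE !eqxx !orbT /=.
move=> /esym; rewrite eq_sym (negPf (neq _ _ x'A yB)) /= => /eqP/psi_inj -> //.
by move=> /esym; rewrite (negPf (neq _ _ xA y'B)) orbF => /eqP/phi_inj -> //.
Qed.

(* Maker joins [q] to [b + 2] vertices of [X] and [q'] to [b + 2] vertices of [Y].
   Of the [(b + 2)^2] pairs thus prepared, all free when they appeared,
   Breaker can have destroyed at most [(b + 1) (b + 2) + b]. *)
Lemma link phi psi q q' X Y d M G :
    M \subset G -> G \subset board -> q \notin X -> q' \notin Y ->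
    {in X &, injective phi} -> {in Y &, injective psi} ->
    (forall x y, x \in X -> y \in Y -> phi x != psi y) ->
    deg G q + b.+1 * b.+2 + #|heavy d G| < #|X| ->
    deg G q' + 2 * (b.+1 * b.+2) + b.+2 * (d + 2 * (b.+1 * b.+2)) < #|Y| ->
  reach board b (b.+2 + b.+2 + 1) (fun M' G' => exists x y,
    [/\ x \in X /\ y \in Y, [set q; x] \in M', [set q'; y] \in M' &
        [set phi x; psi y] \in M']) M G.
Proof.
move=> sMG sGb qX q'Y phi_inj psi_inj neq bigX bigY.
(* Discarding heavy [phi x] gives the second fan its degree bound on the side of [A]. *)
pose X' := [set x in X | phi x \notin heavy d G].
have sX' : X' \subset X by apply/subsetP=> x; rewrite inE => /andP[].
have cX := card_light (heavy d G) phi_inj.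
(* With [set0] for [A] there are no links to guard: the first fan is just a star at [q]. *)
have fanA : reach board b b.+2 (fun M' G' => exists2 B : {set V},
      [/\ B \subset X', #|B| = b.+2 & forall y, y \in B -> [set q; y] \in M'] &
      #|links id phi set0 B :&: G'| <= b.+1 * b.+2) M G.
  apply: (@fan id phi q set0 X' 0) => //.
  - by apply: contraNN qX; apply: (subsetP sX').
  - by move=> x y xX yX; apply: phi_inj; apply: (subsetP sX').
  - by move=> x; rewrite inE.
  - by rewrite cards0 mul0n; rewrite -/X' in cX; move: bigX cX; clear; lia.
rewrite -addnA; apply: reach_bind (reach_growth sMG sGb fanA) _.
move=> M1 G1 [[A [sAX cA qA] _] sM1 sG1 [sMG1 sGb1] cG1].
have degG1 v : deg G1 v <= deg G v + b.+1 * b.+2.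
  by apply: leq_trans (deg_growth G _ v) _; rewrite leq_add2l.
have degA x : x \in A -> deg G1 (phi x) <= d + b.+1 * b.+2.
  move=> /(subsetP sAX); rewrite !inE -ltnNge => /andP[_ lt_d].
  by apply: leq_trans (degG1 _) _; rewrite leq_add2r ltnW.
have fanB := @fan phi psi q' A Y (d + b.+1 * b.+2) b.+2 M1 G1 sMG1 sGb1 q'Y psi_inj degA.
have {}fanB := fanB _.
apply: reach_bind (reach_growth sMG1 sGb1 (fanB _)) _.
  by rewrite cA; move: bigY (degG1 q'); set s := b.+1 * b.+2; set u := b.+2; clear; nia.
move=> M2 G2 [[B [sBY cB q'B] cE] sM2 sG2 [sMG2 sGb2] _].
apply: (@reach_step _ _ _ 0) => F sF cF.
have sAX' := subset_trans sAX sX'.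
have cL : #|links phi psi A B| = b.+2 * b.+2.
  rewrite card_links ?cA ?cB //.
  - by move=> x y xA yA; apply: phi_inj; apply: (subsetP sAX').
  - by move=> x y xA yA; apply: psi_inj; apply: (subsetP sBY).
  - by move=> x y xA yB; apply: neq; [apply: (subsetP sAX') | apply: (subsetP sBY)].
have : 0 < #|links phi psi A B :\: (G2 :|: F)|.
  have := cardsID (G2 :|: F) (links phi psi A B); rewrite cL setIUr.
  have [+ _] := leq_card_setU (links phi psi A B :&: G2) (links phi psi A B :&: F).
  have : #|links phi psi A B :&: F| <= b.
    by apply: leq_trans cF; apply/subset_leq_card/subsetIr.
  move: cE; clear; nia.
case/card_gt0P=> e; rewrite in_setD => /andP[eG /imset2P[x y xA yB eE]].
have xX := subsetP sAX' x xA; have yY := subsetP sBY y yB.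
exists e; first by rewrite in_setD eG eE inE cards2 neq.
apply: reach_now; exists x, y; split=> //.
- by rewrite inE (subsetP sM2) ?orbT // qA.
- by rewrite inE q'B ?orbT.
- by rewrite eE setU11.
Qed.

End Linking.

(** * Cycle surgery *)

Section Surgery.

Variables (V : eqType) (x0 : V) (e : rel V).
Hypothesis e_sym : symmetric e.

Implicit Types (c p s w : seq V).

Lemma last_cat0 s1 s2 : s2 != [::] -> last x0 (s1 ++ s2) = last x0 s2.
Proof. by case: s2 => // y s2 _; rewrite last_cat. Qed.

Lemma head_cat0 s1 s2 : s1 != [::] -> head x0 (s1 ++ s2) = head x0 s1.
Proof. by case: s1. Qed.

Lemma last_rev0 s : last x0 (rev s) = head x0 s.
Proof. by case: s => // y s; rewrite rev_cons last_rcons. Qed.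

Lemma head_rev0 s : head x0 (rev s) = last x0 s.
Proof. by case/lastP: s => // s y; rewrite rev_rcons last_rcons. Qed.

Lemma rev_nil0 s : (rev s == [::]) = (s == [::]).
Proof. by rewrite -!size_eq0 size_rev. Qed.

Lemma sorted_rev s : sorted e (rev s) = sorted e s.
Proof. by rewrite rev_sorted; apply: eq_sorted => u v; rewrite e_sym. Qed.

Lemma cycle_sorted s : s != [::] -> cycle e s = sorted e s && e (last x0 s) (head x0 s).
Proof. by case: s => //= y s _; rewrite rcons_path. Qed.

Lemma cat_nil0 (s1 s2 : seq V) : s1 != [::] -> s1 ++ s2 != [::].
Proof. by case: s1. Qed.

Lemma cycle_cat3 s1 s2 s3 : s1 != [::] -> s2 != [::] -> s3 != [::] ->
    sorted e s1 -> sorted e s2 -> sorted e s3 ->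
    e (last x0 s1) (head x0 s2) -> e (last x0 s2) (head x0 s3) ->
    e (last x0 s3) (head x0 s1) ->
  cycle e (s1 ++ s2 ++ s3).
Proof.
move=> n1 n2 n3 o1 o2 o3 e12 e23 e31.
have n23 := cat_nil0 s3 n2.
rewrite cycle_sorted ?cat_nil0 // !last_cat0 // head_cat0 // e31 andbT.
apply: (@sorted_cat_edge _ x0) => //; last by rewrite head_cat0.
exact: (@sorted_cat_edge _ x0).
Qed.

(** The middle piece is reversed and moved to the end. The two path ends are joined to the two ends
    of that piece, and the third new edge bridges the gap it leaves. *)
Lemma close_path s1 s2 s3 : s1 != [::] -> s2 != [::] -> s3 != [::] ->
    sorted e (s1 ++ s2 ++ s3) ->
    e (head x0 s1) (head x0 s2) -> e (last x0 s3) (last x0 s2) ->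
    e (last x0 s1) (head x0 s3) ->
  cycle e (s1 ++ s3 ++ rev s2).
Proof.
move=> n1 n2 n3 /cat_sorted2[o1 /cat_sorted2[o2 o3]] e12 e32 e13.
apply: cycle_cat3; rewrite ?rev_nil0 ?sorted_rev ?last_rev0 ?head_rev0 //.
by rewrite e_sym.
Qed.

(** The cycle is opened at both junctions of [s1] and [s2]; with [s1] reversed, one pair of ends is
    bridged directly and the other through [p]. *)
Lemma insert_path s1 s2 p : s1 != [::] -> s2 != [::] -> p != [::] ->
    cycle e (s1 ++ s2) -> sorted e p ->
    e (head x0 p) (last x0 s2) -> e (last x0 p) (last x0 s1) ->
    e (head x0 s1) (head x0 s2) ->
  cycle e (p ++ rev s1 ++ s2).
Proof.
move=> n1 n2 np; rewrite cycle_sorted ?cat_nil0 // => /andP[/cat_sorted2[o1 o2] _] op e1 e2 e3.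
apply: cycle_cat3; rewrite ?rev_nil0 ?sorted_rev ?last_rev0 ?head_rev0 //.
by rewrite e_sym.
Qed.

(** The nested defaults express wrapping: a final [y] is followed by the first element, a lone [y]
    by itself. *)
Lemma next_cat s1 y s2 : uniq (s1 ++ y :: s2) ->
  next (s1 ++ y :: s2) y = head (head y s1) s2.
Proof.
move=> un; have yN : y \notin s1.
  by move: un; rewrite cat_uniq => /and3P[_ /norP[]].
rewrite next_nth mem_cat mem_head orbT.
case: s1 yN {un} => [|a s1] /=; first by rewrite eqxx.
rewrite inE negb_or eq_sym => /andP[/negPf-> yN].
rewrite index_cat (negPf yN) /= eqxx addn0 nth_cat ltnNge leqnSn /=.
by rewrite -addn1 addKn.
Qed.

Lemma insert_next c p x y : uniq c -> x \in c -> y \in c -> x != y -> p != [::] ->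
    cycle e c -> sorted e p ->
    e (head x0 p) x -> e (last x0 p) y -> e (next c x) (next c y) ->
  exists2 c', cycle e c' & perm_eq c' (c ++ p).
Proof.
move=> + xc; case/splitPr: xc => c1 c2.
(* Rotating [x] to the end makes its successor the first entry, so cutting after [y] gives the two
   pieces of [insert_path]. *)
have rotE : rot (size c1).+1 (c1 ++ x :: c2) = (c2 ++ c1) ++ [:: x].
  by rewrite -cat_rcons -(size_rcons c1 x) rot_size_cat -cats1 catA.
move=> un; rewrite -(mem_rot (size c1).+1) -(rot_cycle (size c1).+1).
rewrite -!(next_rot (size c1).+1 un).
have : perm_eq (c1 ++ x :: c2) ((c2 ++ c1) ++ [:: x]) by rewrite -rotE perm_sym perm_rot.
move: un; rewrite -(rot_uniq (size c1).+1) rotE; move: (c2 ++ c1) => w un pe.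
rewrite mem_cat inE => /orP[yw|/eqP->]; last by rewrite eqxx.
case/splitPr: yw un pe => w1 w2 un pe xy np cyc op ex ey.
rewrite {1}next_cat // [next _ y](_ : _ = head x0 (w2 ++ [:: x])); last first.
  by rewrite -catA cat_cons next_cat; [case: (w2) | rewrite -cat_cons catA].
rewrite /= => exy.
exists (p ++ rev (w1 ++ [:: y]) ++ (w2 ++ [:: x])).
  apply: insert_path; rewrite -?size_eq0 ?size_cat ?addn1 ?last_cat //=.
  - by rewrite size_eq0.
  - by move: cyc; rewrite -!catA.
  - by move: exy; case: (w1).
rewrite perm_catC; apply: perm_cat => //; rewrite perm_sym.
apply: perm_trans pe _; rewrite -catA cat_cons -[y :: _]cat1s catA.
by rewrite perm_cat2r perm_sym perm_rev.
Qed.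

End Surgery.

(** * Merging paths into a Hamilton cycle *)

Section Merging.

(** [Gam] bounds the number of claimed edges and [Del] the claimed degrees of path ends throughout
    the stage. [d] is the threshold for heavy vertices, and [L] the number of candidates offered to
    each fan. *)
Variables (V : finType) (x0 : V) (b d L Gam Del : nat).
Hypothesis light_enough : forall h, h * d <= 2 * Gam -> Del + b.+1 * b.+2 + h < L.
Hypothesis large_enough :
  Del + 2 * (b.+1 * b.+2) + b.+2 * (d + 2 * (b.+1 * b.+2)) < L.

Implicit Types (ps : seq (seq V)) (p c : seq V) (M G F : {set {set V}}) (X Y : {set V}).

Local Notation board := (complete_graph V).
Local Notation lasts := (lasts x0).
Local Notation heads := (heads x0).

Definition link_time := b.+2 + b.+2 + 1.

Definition cycle_cover c ps M :=
  [/\ cycle (adjacent M) c, all (fun p => p != [::]) ps,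
      perm_eq (c ++ flatten ps) (enum V) & all (sorted (adjacent M)) ps].

(** The bounds reserve room for all edges claimed in the [k] linking phases still to come. *)
Definition within k ps G := #|G| + k * (b.+1 * link_time) <= Gam /\
  forall v, v \in lasts ps :|: heads ps -> deg G v + k * (b.+1 * link_time) <= Del.

Lemma within_step k p ps G G' :
    G \subset G' -> #|G' :\: G| <= b.+1 * link_time ->
    within k.+1 (p :: ps) G -> within k ps G'.
Proof.
move=> sG cG [cGam dDel]; split.
  have := cardsID G G'; rewrite (setIidPr sG); move: cG cGam; rewrite mulSn; clear; lia.
move=> v vLH; have := deg_growth G G' v; have : v \in lasts (p :: ps) :|: heads (p :: ps).
  by move: vLH; rewrite !inE => /orP[] ->; rewrite !orbT.
by move=> /dDel; move: cG; rewrite mulSn; clear; lia.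
Qed.

Lemma link_within phi psi q q' X Y k p ps M G :
    M \subset G -> G \subset board -> within k.+1 (p :: ps) G ->
    q \in lasts (p :: ps) :|: heads (p :: ps) ->
    q' \in lasts (p :: ps) :|: heads (p :: ps) ->
    q \notin X -> q' \notin Y ->
    {in X &, injective phi} -> {in Y &, injective psi} ->
    (forall x y, x \in X -> y \in Y -> phi x != psi y) ->
    L <= #|X| -> L <= #|Y| ->
  reach board b link_time (fun M' G' => exists x y,
    [/\ x \in X /\ y \in Y, M \subset M' & M' \subset G' /\ G' \subset board] /\
    [/\ [set q; x] \in M', [set q'; y] \in M',
        [set phi x; psi y] \in M' & within k ps G']) M G.
Proof.
move=> sMG sGb wi qA q'A qX q'Y phi_inj psi_inj neq LX LY.
have [cG dG] := wi.
have dq := dG q qA; have dq' := dG q' q'A.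
have hv := card_heavy d sGb.
have H1 : deg G q + b.+1 * b.+2 + #|heavy d G| < #|X|.
  have := light_enough (leq_trans hv _); move=> /(_ _)h.
  have /h : 2 * #|G| <= 2 * Gam by move: cG; clear; lia.
  by move: dq LX; clear; lia.
have H2 : deg G q' + 2 * (b.+1 * b.+2) + b.+2 * (d + 2 * (b.+1 * b.+2)) < #|Y|.
  apply: leq_trans LY; apply: leq_ltn_trans large_enough; rewrite !leq_add2r.
  by move: dq'; clear; lia.
have re := link sMG sGb qX q'Y phi_inj psi_inj neq H1 H2.
apply: reach_sub (reach_growth sMG sGb re) => M' G' [[x [y [[xX yY] e1 e2 e3]]] sM sG sb cG'].
exists x, y; split=> //; split=> //.
exact: within_step sG cG' wi.
Qed.

Lemma close_reach k p ps M G :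
    path_cover (p :: ps) M -> M \subset G -> G \subset board ->
    within k.+1 (p :: ps) G -> 2 * L + 4 <= size p ->
  reach board b link_time (fun M' G' => exists c,
    [/\ cycle_cover c ps M', M' \subset G', G' \subset board,
       within k ps G' & size p <= size c]) M G.
Proof.
move=> [ne pe srt] sMG sGb wi big.
have un : uniq p.
  have : uniq (flatten (p :: ps)) by rewrite (perm_uniq pe) enum_uniq.
  by rewrite /= cat_uniq => /and3P[].
pose N := size p; pose h := L.+1.
have hN : h + L < N.-1 by rewrite /h /N; move: big; clear; lia.
(* [X] occupies positions 1 to [L] and [Y] positions [L + 1] to [2 L]. Thus [x] precedes [y], the
   pieces around them are nonempty, and predecessors in [X] never meet successors in [Y]. *)
pose X := [set nth x0 p i.+1 | i : 'I_L].
pose Y := [set nth x0 p (h + i) | i : 'I_L].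
pose phi x := nth x0 p (index x p).-1; pose psi y := nth x0 p (index y p).+1.
have idx i : i < N -> index (nth x0 p i) p = i by move=> iN; rewrite index_uniq.
have XP x : x \in X -> exists i, [/\ x = nth x0 p i, 0 < i & i < h].
  by case/imsetP=> i _ ->; exists i.+1; split=> //; have := ltn_ord i.
have YP y : y \in Y -> exists j, [/\ y = nth x0 p j, h <= j & j < N.-1].
  case/imsetP=> i _ ->; exists (h + i); split=> //; first by rewrite leq_addr.
  by have := ltn_ord i; move: hN; clear; lia.
have injn i j : i < N -> j < N -> nth x0 p i = nth x0 p j -> i = j.
  by move=> iN jN /eqP; rewrite nth_uniq // => /eqP.
have cX : #|X| = L.
  rewrite card_imset ?card_ord // => i j /injn eq_ij; apply/val_inj/succn_inj/eq_ij.
    by have := ltn_ord i; move: hN; rewrite /h; clear; lia.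
  by have := ltn_ord j; move: hN; rewrite /h; clear; lia.
have cY : #|Y| = L.
  rewrite card_imset ?card_ord // => i j /injn eq_ij; apply/val_inj/(@addnI h)/eq_ij.
    by have := ltn_ord i; move: hN; clear; lia.
  by have := ltn_ord j; move: hN; clear; lia.
have headE : head x0 p = nth x0 p 0 by rewrite nth0.
have lastE : last x0 p = nth x0 p N.-1 by rewrite nth_last.
have N0 : 0 < N by move: hN; clear; lia.
have qX : head x0 p \notin X.
  apply/negP=> /XP[i [+ i0 ih]]; rewrite headE => /injn eq0.
  have iN : i < N by move: ih hN; clear; lia.
  by move: (eq0 N0 iN) i0; clear; lia.
have q'Y : last x0 p \notin Y.
  apply/negP=> /YP[j [+ jh jN]]; rewrite lastE => /injn eq0.
  have jN' : j < N by move: jN; clear; lia.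
  have lN : N.-1 < N by move: N0; clear; lia.
  by move: (eq0 lN jN') jN; clear; lia.
have phiE i : 0 < i < h -> phi (nth x0 p i) = nth x0 p i.-1.
  by move=> ih; rewrite /phi idx //; move: ih hN; clear; lia.
have psiE j : h <= j < N.-1 -> psi (nth x0 p j) = nth x0 p j.+1.
  by move=> jh; rewrite /psi idx //; move: jh hN; clear; lia.
have phi_inj : {in X &, injective phi}.
  move=> x y /XP[i [-> i0 ih]] /XP[j [-> j0 jh]].
  rewrite !phiE ?i0 ?j0 // => /injn eq_ij.
  have iN : i.-1 < N by move: ih hN; clear; lia.
  have jN : j.-1 < N by move: jh hN; clear; lia.
  by rewrite -(prednK i0) -(prednK j0) (eq_ij iN jN).
have psi_inj : {in Y &, injective psi}.
  move=> x y /YP[i [-> i0 ih]] /YP[j [-> j0 jh]].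
  rewrite !psiE ?i0 ?j0 // => /injn eq_ij.
  have iN : i.+1 < N by move: ih; clear; lia.
  have jN : j.+1 < N by move: jh; clear; lia.
  by rewrite (succn_inj (eq_ij iN jN)).
have neq x y : x \in X -> y \in Y -> phi x != psi y.
  move=> /XP[i [-> i0 ih]] /YP[j [-> jh jN]]; rewrite phiE ?i0 // psiE ?jh //.
  have iN : i.-1 < size p by rewrite -/N; move: ih jh jN; clear; lia.
  have jN' : j.+1 < size p by rewrite -/N; move: jN; clear; lia.
  by rewrite nth_uniq //; move: ih jh; clear; lia.
have hA : head x0 p \in lasts (p :: ps) :|: heads (p :: ps) by rewrite !inE eqxx !orbT.
have lA : last x0 p \in lasts (p :: ps) :|: heads (p :: ps) by rewrite !inE eqxx.
have LX : L <= #|X| by rewrite cX.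
have LY : L <= #|Y| by rewrite cY.
have re := link_within sMG sGb wi hA lA qX q'Y phi_inj psi_inj neq LX LY.
apply: reach_sub re => M' G' [x [y [[[xX yY] sM [sMG' sGb']] [e1 e2 e3 wi']]]].
have [i [xE i0 ih]] := XP x xX; have [j [yE jh jN]] := YP y yY.
move: e1 e2 e3; rewrite xE yE phiE ?i0 // psiE ?jh // headE lastE => e1 e2 e3.
pose s1 := take i p; pose s2 := take (j.+1 - i) (drop i p); pose s3 := drop j.+1 p.
have pE : p = s1 ++ s2 ++ s3.
  rewrite /s1 /s2 /s3 -[in LHS](cat_take_drop i p) -[in X in _ ++ X = _](cat_take_drop (j.+1 - i) (drop i p)).
  by rewrite drop_drop subnK //; move: ih jh; clear; lia.
have z1 : size s1 = i by rewrite size_takel //; move: ih hN; rewrite -/N; clear; lia.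
have z2 : size s2 = j.+1 - i.
  by rewrite size_takel // size_drop -/N; move: jN; clear; lia.
have z3 : size s3 = N - j.+1 by rewrite size_drop.
have ij : i <= j by move: ih jh; clear; lia.
have sp : sorted (adjacent M') p.
  by move: srt => /= /andP[+ _]; apply: sub_sorted; apply: adjacent_sub.
exists (s1 ++ s3 ++ rev s2); split=> //; last first.
  by rewrite {1}pE !size_cat size_rev; clear; lia.
split.
- apply: (@close_path _ x0); rewrite -?size_eq0 -?pE //.
  + exact: adjacent_sym.
  + by rewrite z1 -lt0n.
  + by rewrite z2; move: ij; clear; lia.
  + by rewrite z3; move: jN; clear; lia.
  + rewrite -!nth0 /s1 /s2 !nth_take ?nth_drop ?addn0 //.
    by move: ij; clear; lia.
  + rewrite -!nth_last z2 z3 nth_drop /s2 nth_take ?nth_drop; last by move: ij; clear; lia.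
    rewrite (_ : j.+1 + (N - j.+1).-1 = N.-1) 1?(_ : i + (j.+1 - i).-1 = j) //.
      by move: ij; clear; lia.
    by move: jN; clear; lia.
  + rewrite -nth_last z1 nth_take -?nth0 ?nth_drop ?addn0 //.
    by move: i0; clear; lia.
- by move: ne => /= /andP[].
- apply: perm_trans pe; rewrite /= perm_cat2r pE perm_cat2l perm_catC.
  by rewrite perm_cat2r perm_rev.
- move: srt => /= /andP[_]; apply: sub_all => r; apply: sub_sorted; exact: adjacent_sub.
Qed.

Lemma insert_reach k c p ps M G :
    cycle_cover c (p :: ps) M -> M \subset G -> G \subset board ->
    within k.+1 (p :: ps) G -> 2 * L <= size c ->
  reach board b link_time (fun M' G' => exists c',
    [/\ cycle_cover c' ps M', M' \subset G', G' \subset board,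
       within k ps G' & size c <= size c']) M G.
Proof.
move=> [cyc ne pe srt] sMG sGb wi big.
have un : uniq (c ++ p ++ flatten ps) by rewrite (perm_uniq pe) enum_uniq.
have unc : uniq c by move: un; rewrite cat_uniq => /andP[].
have [np _] := andP ne.
have cp v : v \in p -> v \notin c.
  move=> vp; move: un; rewrite cat_uniq => /and3P[_ /hasPn/(_ v) + _]; apply.
  by rewrite mem_cat vp.
(* Any two disjoint parts of the cycle serve, since [next] is injective and so keeps their
   successors apart. *)
pose X := [set x in take L c]; pose Y := [set x in drop L c].
have unX : uniq (take L c) by apply: take_uniq.
have unY : uniq (drop L c) by apply: drop_uniq.
have cX : L <= #|X|.
  rewrite cardsE (card_uniqP unX) size_takel //; move: big; clear; lia.
have cY : L <= #|Y|.
  by rewrite cardsE (card_uniqP unY) size_drop; move: big; clear; lia.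
have Xc x : x \in X -> x \in c by rewrite inE => /mem_take.
have Yc x : x \in Y -> x \in c by rewrite inE => /mem_drop.
have neqXY x y : x \in X -> y \in Y -> x != y.
  rewrite !inE => xX yY; apply: contraTneq unc => xy.
  rewrite -(cat_take_drop L c) cat_uniq; apply/negP => /and3P[_ /hasPn/(_ y yY)].
  by rewrite /= -xy xX.
have next_inj : injective (next c).
  by move=> x y /(congr1 (prev c)); rewrite !prev_next.
have hA : head x0 p \in lasts (p :: ps) :|: heads (p :: ps) by rewrite !inE eqxx !orbT.
have lA : last x0 p \in lasts (p :: ps) :|: heads (p :: ps) by rewrite !inE eqxx.
have qX : head x0 p \notin X.
  by apply: contra (cp _ (head_mem x0 np)); apply: Xc.
have q'Y : last x0 p \notin Y.
  by apply: contra (cp _ (last_mem x0 np)); apply: Yc.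
have neq x y : x \in X -> y \in Y -> next c x != next c y.
  by move=> xX yY; rewrite (inj_eq next_inj) neqXY.
have re := link_within sMG sGb wi hA lA qX q'Y (in2W next_inj) (in2W next_inj) neq cX cY.
apply: reach_sub re => M' G' [x [y [[[xX yY] sM [sMG' sGb']] [e1 e2 e3 wi']]]].
have sp : sorted (adjacent M') p.
  by move: srt => /= /andP[+ _]; apply: sub_sorted; apply: adjacent_sub.
have cyc' : cycle (adjacent M') c by apply: sub_cycle cyc; apply: adjacent_sub.
have [c' cyc'' pe'] := insert_next (@adjacent_sym _ M') unc (Xc _ xX) (Yc _ yY) (neqXY _ _ xX yY)
  np cyc' sp e1 e2 e3.
exists c'; split=> //; last by rewrite (perm_size pe') size_cat leq_addr.
split=> //.
- by move: ne => /= /andP[].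
- by apply: perm_trans pe; rewrite /= catA perm_cat2r.
- move: srt => /= /andP[_]; apply: sub_all => r; apply: sub_sorted; exact: adjacent_sub.
Qed.

Lemma merge_reach c ps M G :
    cycle_cover c ps M -> M \subset G -> G \subset board ->
    within (size ps) ps G -> 2 * L <= size c ->
  reach board b (size ps * link_time) (fun M' _ => exists c', cycle_cover c' [::] M') M G.
Proof.
elim: ps c M G => [|p ps IHps] c M G cov sMG sGb wi big.
  by apply: reach_now; exists c.
rewrite [size (_ :: _)]/= mulSn; apply: reach_bind (insert_reach cov sMG sGb wi big) _.
move=> M' G' [c' [cov' sMG' sGb' wi' le_c]].
by apply: IHps cov' sMG' sGb' wi' _; apply: leq_trans le_c.
Qed.

Lemma hamilton_reach p ps M G :
    path_cover (p :: ps) M -> M \subset G -> G \subset board ->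
    within (size (p :: ps)) (p :: ps) G -> 2 * L + 4 <= size p -> 2 < #|V| ->
  reach board b (size (p :: ps) * link_time)
    (fun M' _ => contains_hamilton_cycle M') M G.
Proof.
move=> cov sMG sGb wi big V2.
rewrite [size _]/= mulSn; apply: reach_bind (close_reach cov sMG sGb wi big) _.
move=> M' G' [c [cov' sMG' sGb' wi' le_c]].
have le2 : 2 * L <= size c by apply: leq_trans le_c; apply: leq_trans big; apply: leq_addr.
apply: reach_sub (merge_reach cov' sMG' sGb' wi' le2) => M'' _ [c' [cyc _ + _]].
rewrite cats0 => pe; split=> //; exists c'; split.
  by rewrite /ucycle cyc (perm_uniq pe) enum_uniq.
by rewrite (perm_size pe) -cardE.
Qed.

End Merging.

(** * The two stages together *)

Definition cover_size b := 128 * (4 * b + 6) * (2 * up_log 2 b + 40).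

Section Assembly.
Import Order.TTheory GRing.Theory Num.Theory.

Lemma base_exp_ge2 (R : realFieldType) a : 0 < a -> (2 <= base R a ^+ a :> R)%R.
Proof.
move=> a0; have := weight_linear R a0 a; rewrite /weight.
have -> : ((base R a - 1) * a%:R = 1 :> R)%R.
  by rewrite /base [(1 + _)%R]addrC addrK mulVf // pnatr_eq0 -lt0n.
by move=> ?; lra.
Qed.

(** As [base ^+ a >= 2], the power in [large_cover] is at least [2 ^ k] for [k = (m - c) / a]. On
    the other side [m + 3 <= a (k + 2)] and [a <= 2 ^ (10 + l)], so the logarithmic factor in
    [cover_size] makes [k] large enough. *)
Lemma large_cover_ge (R : realFieldType) b m :
  2 <= b -> cover_size b <= m -> large_cover R b m.
Proof.
rewrite /cover_size => b2 le_m; set a := 128 * (4 * b + 6) in le_m *; set c := 4 * b + 6 in a le_m *.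
set l := up_log 2 b in le_m.
have a0 : 0 < a by rewrite /a /c; clear; lia.
have ca : c <= a by rewrite /a; clear; lia.
split; first by apply: leq_trans le_m; rewrite -/c -/a mulnC leq_mul2l leq_addl orbT.
rewrite -/c -/a; set k := (m - c) %/ a.
have k_ge : 2 * l + 39 <= k.
  rewrite leq_divRL // mulnC; move: le_m ca; rewrite !mulnDr; clear; lia.
have m_lt : m + 3 <= a * (k + 2).
  have : m - c < a * k.+1 by rewrite mulnC ltn_ceil.
  have : 3 <= c by rewrite /c; clear; lia.
  move: ca; rewrite mulnS mulnDr; clear; lia.
have a_le : a <= 2 ^ (10 + l).
  have bl : b <= 2 ^ l by apply: up_logP.
  rewrite (_ : 10 + l = 7 + (3 + l)) // !expnD -[2 ^ 7]/128 -[2 ^ 3]/8.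
  rewrite /a leq_mul2l /=; apply: leq_trans (leq_mul (leqnn 8) bl).
  by rewrite /c; move: b2; clear; lia.
have k_exp : k + 2 <= 2 ^ (k - (10 + l)).
  have [r rE] : exists r, k - (10 + l) = r.+1 by exists (k - (10 + l)).-1; move: k_ge; clear; lia.
  rewrite rE expnS; have := ltn_expl r (isT : 1 < 2).
  by move: k_ge rE; clear; lia.
have m_exp : m + 3 <= 2 ^ k.
  apply: leq_trans m_lt _; apply: leq_trans (leq_mul a_le k_exp) _.
  by rewrite -expnD subnKC //; move: k_ge; clear; lia.
have : ((m + 3)%:R <= (2 ^ k)%:R :> R)%R by rewrite ler_nat.
rewrite natrD natrX => /le_trans; apply.
apply: le_trans (_ : (base R a ^+ a) ^+ k <= _)%R.
  by rewrite lerXn2r ?nnegrE ?base_exp_ge2 // exprn_ge0 // ltW // base_gt0.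
rewrite -exprM; apply: ler_weXn2l; first exact: base_ge1.
by rewrite mulnC leq_divM.
Qed.

Lemma exists_long (T : eqType) (ps : seq (seq T)) :
  ps != [::] -> exists2 p, p \in ps & size (flatten ps) <= size p * size ps.
Proof.
elim: ps => // p ps IHps _.
have [->|/IHps[p' p'ps le_p']] := eqVneq ps [::].
  by exists p; rewrite ?mem_head //= cats0 muln1.
rewrite /= size_cat; case: (leqP (size p) (size p')) => [le_pp'|/ltnW le_p'p].
  by exists p'; rewrite ?inE ?p'ps ?orbT // mulnS leq_add.
exists p; rewrite ?mem_head // mulnS leq_add2l; apply: leq_trans le_p' _.
by rewrite leq_mul2r le_p'p orbT.
Qed.

(** The quotient [u = n / W] is the heaviness threshold of both stages. At most [M1] paths survive
    the covering stage, so a longest one has at least [n / M1 >= 64 B u] vertices, ample room for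
    [L = 16 B u] candidates on each side. Path ends keep degree at most [2 u]. *)
Lemma hamilton_within (n b : nat) : 2 <= b ->
    (64 * (cover_size b + 3) * b.+2) ^ 5 <= n ->
  maker_can_win_hamilton_within n b (n + link_time b * (cover_size b + 3)).
Proof.
move=> b2; set M0 := cover_size b; set M1 := M0 + 3; set B := b.+2; set W := 64 * M1 * B => Wn.
have large m := @large_cover_ge rat b m b2; rewrite -/M0 in large.
have B4 : 4 <= B by rewrite /B.
have M0B : B <= M0.
  rewrite /M0 /cover_size -[B]muln1; apply: leq_mul; first by rewrite /B; clear; lia.
  by apply: (@leq_trans 40); rewrite ?leq_addl.
have M1B : B <= M1 by apply: leq_trans M0B (leq_addr _ _).
have BW : 64 * (B * B) <= W by rewrite /W -mulnA leq_mul2l leq_mul2r M1B !orbT.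
have MW : 64 * (M1 * B) = W by rewrite /W mulnA.
clearbody W.
have MB : M1 <= M1 * B by rewrite leq_pmulr //; move: B4; clear; lia.
have BB : B <= B * B by rewrite leq_pmulr //; move: B4; clear; lia.
have W64 : 64 <= W by move: BW BB B4; clear; lia.
set rho := link_time b; have rhoE : rho = 2 * B + 1 by rewrite /rho /link_time -/B; clear; lia.
set u := n %/ W.
have W_gt0 : 0 < W by move: W64; clear; lia.
have u_ge : 64 * (W * W) <= u.
  rewrite leq_divRL // ; apply: leq_trans Wn; rewrite (_ : 5 = 1 + 1 + 1 + 1 + 1) // !expnD !expn1.
  by rewrite -!mulnA; apply: leq_mul => //; rewrite leq_pmull.
have n_lt : n < W * u.+1 by rewrite mulnC ltn_ceil.
have n_ge : W * u <= n by rewrite mulnC leq_divM.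
have WW : W <= W * W by rewrite leq_pmulr.
have u_gt0 : 0 < u by move: u_ge WW W_gt0; clear; lia.
have n_le : n <= 2 * W * u.
  apply: leq_trans (ltnW n_lt) _; rewrite -mulnA mulnCA leq_mul2l; apply/orP; right.
  by move: u_gt0; clear; lia.
have bB : b.+1 <= B by [].
set s := b.+1 * rho.
have s_le : s <= 3 * (B * B).
  rewrite mulnCA; apply: leq_mul => //; rewrite rhoE; move: B4; clear; lia.
have Ms : M1 * s <= W * W.
  apply: leq_trans (leq_mul (leqnn M1) s_le) _; rewrite mulnCA !mulnA -[3 * M1 * B]mulnA.
  by apply: leq_mul; move: MW BW BB; clear; lia.
have Bb : b.+1 * B <= B * B by rewrite leq_mul2r bB orbT.
have n_gt0 : 0 < n by apply: leq_trans n_ge; rewrite muln_gt0 W_gt0.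
pose x0 := Ordinal n_gt0.
have M1n : M1 <= n.
  apply: leq_trans n_ge; apply: (@leq_trans W); first by move: MW MB; clear; lia.
  by rewrite leq_pmulr.
(* The two terms of [Gam] account for the covering stage and for at most [M1] linking phases of [s]
   edges each. *)
pose Gam := b.+1 * n + M1 * s; pose L := 16 * (B * u).
have uB : 4 * u <= B * u by rewrite leq_mul2r B4 orbT.
have light h : h * u <= 2 * Gam -> 2 * u + b.+1 * b.+2 + h < L.
  move=> hu; suff h_le : h <= W * W.
    by rewrite /L; move: Bb uB BW BB WW u_ge h_le u_gt0; rewrite -/B; clear; lia.
  have Gam_le : 2 * Gam <= (4 * (B * W) + 1) * u.
    rewrite /Gam mulnDr mulnDl mul1n leq_add //.
      apply: (@leq_trans (2 * (B * (2 * W * u)))).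
        by rewrite leq_mul2l; apply/orP; right; apply: leq_mul.
      by clear; nia.
    by move: Ms u_ge; clear; lia.
  have : h <= 4 * (B * W) + 1 by rewrite -(leq_pmul2r u_gt0); apply: leq_trans hu _.
  move/leq_trans; apply; apply: (@leq_trans (5 * B * W)).
    have : 0 < B * W by rewrite muln_gt0 W_gt0.
    by rewrite -!mulnA; clear; lia.
  by rewrite leq_mul2r; apply/orP; right; move: BW BB; clear; lia.
have big : 2 * u + 2 * (b.+1 * b.+2) + b.+2 * (u + 2 * (b.+1 * b.+2)) < L.
  rewrite /L -/B mulnDr.
  have : B * (2 * (b.+1 * B)) <= W * W.
    by apply: leq_mul; move: BW BB Bb; clear; lia.
  by move: Bb uB BW WW u_ge u_gt0; clear; lia.
have re1 : reach (complete_graph 'I_n) b (n - M0) (fun M G => exists2 ps, covering_invariant x0 rat b u ps M G &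
     M0 <= size ps < M0 + 4) set0 set0.
  have := invariant_loop large (invariant_start x0 rat b u).
  by rewrite size_map -cardE card_ord; apply; apply: leq_trans M1n; rewrite leq_addr.
apply: (reach_wins (set0 : {set 'I_n})).
apply: (@reach_le _ _ _ ((n - M0) + rho * M1)); first by rewrite leq_add2r leq_subr.
apply: reach_bind re1 _ => M G [ps [st cG dG] /andP[le_M0 lt_M1]].
have ps_le : size ps <= M1 by move: lt_M1; rewrite /M1; clear; lia.
have [cov [sMG sGb] _] := st.
have ps0 : ps != [::] by rewrite -size_eq0 -lt0n; apply: leq_trans le_M0; apply: leq_trans M0B.
have [p pps long] := exists_long ps0.
have flE : size (flatten ps) = n.
  by case: cov => _ /perm_size -> _; rewrite -cardE card_ord.
have p_ge : 64 * (B * u) <= size p.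
  have M1_gt0 : 0 < M1 by apply: leq_trans M1B.
  rewrite -(leq_pmul2r M1_gt0); apply: (@leq_trans n).
    by apply: leq_trans n_ge; rewrite -MW; clear; nia.
  by move: long; rewrite flE => /leq_trans; apply; rewrite leq_mul2l ps_le orbT.
(* [relieved] is at most twice the number of heavy vertices, and [card_heavy] bounds that number
   through the at most [(b + 1) n] claimed edges. *)
have rel_le : relieved x0 u ps G <= 8 * (B * W).
  rewrite -(leq_pmul2r u_gt0).
  have hv := card_heavy u sGb.
  have : relieved x0 u ps G <= 2 * #|heavy u G|.
    by rewrite mul2n -addnn leq_add //; apply/subset_leq_card/subsetDl.
  move=> /(leq_mul)/(_ (leqnn u))/leq_trans; apply.
  apply: (@leq_trans (4 * (B * n))).
    have : b.+1 * n <= B * n by rewrite leq_mul2r bB orbT.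
    rewrite -mulnA; move: hv (leq_trans (leq_addr _ _) cG); rewrite card_ord.
    by move: (#|_| * u) (b.+1 * n) (B * n) #|G|; clear; lia.
  have : B * n <= B * (2 * W * u) by rewrite leq_mul2l n_le orbT.
  by clear; nia.
have wi : within x0 b Gam (2 * u) (size ps) ps G.
  split.
    rewrite /Gam -/rho -/s leq_add ?leq_mul2r ?ps_le ?orbT //.
    by move: (leq_trans (leq_addr _ _) cG); rewrite card_ord.
  move=> v /dG; rewrite -/rho -/s => dv.
  have : size ps * s <= W * W by apply: leq_trans Ms; rewrite leq_mul2r ps_le orbT.
  have : 4 * b.+1 * (relieved x0 u ps G).+1 <= 4 * B * (8 * (B * W)).+1.
    by apply: leq_mul => //; rewrite leq_mul2l bB.
  have : 4 * B * (8 * (B * W)).+1 <= 2 * (W * W).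
    have : 64 * (B * B) * W <= W * W by rewrite leq_mul2r BW orbT.
    by move: BW BB WW; clear; nia.
  by move: dv u_ge WW W_gt0; clear; lia.
have pe := perm_to_rem pps.
have cov' := perm_path_cover pe cov.
have wi' : within x0 b Gam (2 * u) (size (p :: rem p ps)) (p :: rem p ps) G.
  by rewrite -(perm_size pe) /within -(perm_lasts x0 pe) -(perm_heads x0 pe).
have p_ge' : 2 * L + 4 <= size p.
  by apply: leq_trans p_ge; rewrite /L; move: uB u_gt0; clear; lia.
have n2 : 2 < #|'I_n|.
  by rewrite card_ord; apply: leq_trans M1n; rewrite /M1 addnC.
have re2 := hamilton_reach light big cov' sMG sGb wi' p_ge' n2.
apply: reach_le re2; rewrite -(perm_size pe) mulnC leq_mul2l; apply/orP; right; exact: ps_le.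
Qed.

End Assembly.

(** * Asymptotics *)

Lemma cover_size_linear b : 2 <= b ->
  cover_size b <= 128 * 7 * b * (2 * up_log 2 b + 40).
Proof.
by move=> b2; rewrite leq_mul2r; apply/orP; right; rewrite -mulnA leq_mul2l; move: b2; clear; lia.
Qed.

(** The crude bound [up_log 2 b <= b] suffices: a requirement polynomial in [b] is met once
    [b <= ln n] and [n] is large. *)
Lemma cover_size_cubic : exists K, forall b, 2 <= b ->
  64 * (cover_size b + 3) * b.+2 <= K * b ^ 3.
Proof.
exists (64 * (128 * 7 * 22 + 3) * 2) => b b2.
have lb : up_log 2 b <= b by apply: up_log_min => //; apply/ltnW/ltn_expl.
have h1 : cover_size b <= 128 * 7 * b * (22 * b).
  by apply: leq_trans (cover_size_linear b2) _; rewrite leq_mul2l; apply/orP; right; move: lb b2; clear; lia.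
have h2 : cover_size b + 3 <= (128 * 7 * 22 + 3) * (b * b).
  rewrite mulnDl leq_add //.
    by apply: leq_trans h1 _; rewrite mulnACA.
  by move: b2; clear; nia.
have h3 : b.+2 <= 2 * b by move: b2; clear; lia.
move: (128 * 7 * 22 + 3) h2 => c h2.
apply: leq_trans (leq_mul (leq_mul (leqnn 64) h2) h3) _.
by rewrite [64 * (_ * _)]mulnA mulnACA !expnS expn0 muln1 -[b * b * b]mulnA.
Qed.

From mathcomp Require Import all_classical all_reals all_analysis.

Import Order.TTheory GRing.Theory Num.Theory.
Import numFieldNormedType.Exports.

Local Open Scope classical_set_scope.
Local Open Scope ring_scope.

(** Rounding up adds less than 1, which the factor 2 covers because the binary logarithm of [b] is
    at least 1. *)
Lemma up_log_le_ln (R : realType) b : (2 <= b)%N ->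
  (up_log 2 b)%:R <= 2 * (ln (b%:R : R) / ln 2).
Proof.
move=> b2; have l2 : 0 < ln (2 : R) by rewrite ln_gt0 // ltr1n.
have b_gt0 : 0 < b%:R :> R by rewrite ltr0n; apply: ltn_trans b2.
have y1 : 1 <= ln (b%:R : R) / ln 2.
  by rewrite ler_pdivlMr // mul1r ler_ln ?posrE // (ler_nat R 2).
have l0 : (0 < up_log 2 b)%N by rewrite up_log_gt0.
have := up_log_gtn (isT : (1 < 2)%N) b2; rewrite -(ltr_nat R) natrX -ltr_ln ?posrE ?exprn_gt0 //.
rewrite lnXn // => lt_l.
have : (up_log 2 b).-1%:R <= ln (b%:R : R) / ln 2.
  by rewrite ler_pdivlMr // mulr_natl ltW.
have : (up_log 2 b)%:R = (up_log 2 b).-1%:R + 1 :> R by rewrite natr1 prednK.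
by move: y1; lra.
Qed.

Lemma total_moves (R : realType) b : (2 <= b)%N ->
  (link_time b * (cover_size b + 3))%:R <=
    5 * (128 * 7 * 44 + 3) / ln 2 * b%:R ^+ 2 * ln (b%:R : R).
Proof.
move=> b2; have := up_log_le_ln R b2; set y := ln _ / ln 2 => ly.
have l2 : 0 < ln (2 : R) by rewrite ln_gt0 // ltr1n.
have y1 : 1 <= y.
  have b_gt0 : 0 < b%:R :> R by rewrite ltr0n; apply: ltn_trans b2.
  by rewrite ler_pdivlMr // mul1r ler_ln ?posrE // (ler_nat R 2).
have h1 : (link_time b <= 5 * b)%N by rewrite /link_time; lia.
have h2 := cover_size_linear b2.
have : (link_time b * (cover_size b + 3) <= 5 * b * (128 * 7 * b * (2 * up_log 2 b + 40) + 3))%N.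
  by rewrite leq_mul // leq_add2r.
rewrite -(ler_nat R) => /le_trans; apply.
have b1 : 1 <= b%:R :> R by rewrite ler1n ltnW.
rewrite !natrM !natrD !natrM !natrD.
have -> : 5 * (128 * 7 * 44 + 3) / ln 2 * b%:R ^+ 2 * ln (b%:R : R) =
   5 * b%:R * ((128 * 7 * 44 + 3) * (b%:R * y)) by rewrite /y; field; rewrite gt_eqF.
rewrite ler_pM2l; last by rewrite mulr_gt0 //; lra.
have by1 : 1 <= b%:R * y by rewrite mulr_ege1.
(* 44 is [2 * 2 + 40], by [up_log 2 b <= 2 y] and [1 <= y]. *)
have : b%:R * (2 * (up_log 2 b)%:R + 40) <= b%:R * (44 * y).
  by rewrite ler_wpM2l //; lra.
by lra.
Qed.

(** [expR x] is the 16th power of [expR (x / 16)], hence at least [(x / 16) ^+ 16]; one factor [x]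
    pays for [K * 16 ^+ 16]. *)
Lemma exp_dominates (R : realType) (x K : R) : 0 <= K -> K * 16 ^+ 16 <= x ->
  K * x ^+ 15 <= expR x.
Proof.
move=> K0 Kx; have x0 : 0 <= x by apply: le_trans Kx; rewrite mulr_ge0 // exprn_ge0.
have xE : 16%:R * (x / 16) = x by rewrite mulrC divfK.
rewrite -[in leRHS]xE expRM_natl.
apply: (@le_trans _ _ ((x / 16) ^+ 16)).
  rewrite expr_div_n ler_pdivlMr ?exprn_gt0 // mulrAC [leRHS]exprS.
  by rewrite ler_wpM2r // exprn_ge0.
rewrite lerXn2r ?nnegrE ?expR_ge0 ?divr_ge0 //.
by apply: le_trans (expR_ge1Dx _); rewrite lerDr.
Qed.

Theorem theorem1p2 (R : realType) :
  exists C : R, 0 < C /\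
    forall b : nat -> nat,
      (forall n : nat, (2 <= b n)%N) ->
      ((b n)%:R * ln (ln (n%:R : R)) / ln (n%:R : R)) @[n --> \oo] --> (0 : R) ->
      \forall n \near \oo,
        exists m : nat,
          (m%:R : R) <= n%:R + C * (b n)%:R ^+ 2 * ln ((b n)%:R : R) /\
          maker_can_win_hamilton_within n (b n) m.
Proof.
have l2 : 0 < ln (2 : R) by rewrite ln_gt0 // ltr1n.
exists (5 * (128 * 7 * 44 + 3) / ln 2); split; first by rewrite divr_gt0.
move=> b b2 blim; have [K KP] := cover_size_cubic.
have small : \forall n \near \oo, (b n)%:R * ln (ln (n%:R : R)) / ln (n%:R : R) < 1.
  by apply: (cvgr_lt _ blim); exact: ltr01.
near=> n.
(* This makes [ln (ln n)] at least 1, so the smallness of [b] yields [b n <= ln n]. The next bound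
   is what [exp_dominates] asks of [ln n]. *)
have big1 : expR (expR 1) <= n%:R :> R by near: n; apply: nbhs_infty_ger.
have big2 : expR ((K ^ 5)%:R * 16 ^+ 16) <= n%:R :> R by near: n; apply: nbhs_infty_ger.
have lt1 : (b n)%:R * ln (ln (n%:R : R)) / ln (n%:R : R) < 1 by near: n; exact: small.
have n0 : 0 < n%:R :> R by apply: lt_le_trans big1; apply: expR_gt0.
set x := ln (n%:R : R) in lt1.
have nE : n%:R = expR x by rewrite lnK.
have x_ge : expR 1 <= x by rewrite -ler_expR -nE.
have x_gt0 : 0 < x by apply: lt_le_trans x_ge; apply: expR_gt0.
have lnx : 1 <= ln x by rewrite -[1]expRK ler_ln ?posrE // expR_gt0.
have bx : (b n)%:R <= x.
  move: lt1; rewrite ltr_pdivrMr // mul1r => /ltW; apply: le_trans.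
  by rewrite ler_peMr.
have Kx : (K ^ 5)%:R * 16 ^+ 16 <= x by rewrite -ler_expR -nE.
exists (n + link_time (b n) * (cover_size (b n) + 3))%N; split.
  by rewrite natrD lerD2l total_moves.
apply: hamilton_within => //.
(* The fifth power of a cubic bound gives the exponent 15 of [exp_dominates]. *)
apply: leq_trans (_ : (K * b n ^ 3) ^ 5 <= n)%N; first by rewrite leq_exp2r // KP.
rewrite -(ler_nat R) expnMn -expnM natrM [((b n) ^ _)%:R]natrX nE.
apply: (@le_trans _ _ ((K ^ 5)%:R * x ^+ 15)); last exact: exp_dominates.
by rewrite ler_wpM2l //; apply: lerXn2r; rewrite ?nnegrE //; apply: ltW.
Unshelve. all: by end_near.
Qed.
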